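(* Let $\{x_k,y_k\}_{k\ge0}$ be generated by $$x_{k+1}=\mathcal{P}_{\mathcal X}\big(x_k+\alpha_k(\nabla_xH(x_k,y_k)+M_{k+1})\big),\qquad y_{k+1}=y_k+\beta_k\big(-\nabla_yH(x_k,y_k)+M'_{k+1}\big),$$ where $H:\mathcal X\times\mathbb{R}^{d_2}\to\mathbb{R}$ is $L$-smooth, $\rho$-strongly concave in $x$ (for some $L,\rho>0$) and convex in $y$, $\mathcal X\subset\mathbb{R}^{d_1}$ is a convex set with bounded diameter, and the noise satisfies the assumption in the context. Let $\epsilon\in(0,1/4)$ be arbitrary and let the step sizes be of order $\alpha_k\sim 1/(k+1)^{0.5+0.66\epsilon}$ and $\beta_k\sim1/(k+1)^{0.75+\epsilon}$, precisely as specified in the context. Then the iterates $(x_k,y_k)$ converge almost surely to the set of saddle points of $H$ (the distance from $(x_k,y_k)$ to this set tends to $0$), and $$\mathbb{E}\big[\|\nabla\Phi(y_k)\|^2\big]\le\mathcal{O}\big(1/k^{1/4-\epsilon}\big).$$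
   Context: $\|\cdot\|$ is the Euclidean norm. $\mathcal X$ is non-empty and closed, and $\mathcal{P}_{\mathcal X}(x)=\arg\min_{x'\in\mathcal X}\|x-x'\|$. $L$-smooth means that $H$ is differentiable with $L$-Lipschitz gradient on $\mathcal X\times\mathbb{R}^{d_2}$. The problem is $\min_{y\in\mathbb{R}^{d_2}}\max_{x\in\mathcal X}H(x,y)$, and $\Phi(y)=\max_{x\in\mathcal X}H(x,y)$. A saddle point is a pair $(\bar x,\bar y)\in\mathcal X\times\mathbb{R}^{d_2}$ with $H(x,\bar y)\le H(\bar x,\bar y)\le H(\bar x,y)$ for all $x\in\mathcal X$, $y\in\mathbb{R}^{d_2}$; the set of saddle points is assumed non-empty. The initial points $x_0\in\mathcal X$, $y_0\in\mathbb{R}^{d_2}$ are deterministic. Noise: with $\mathcal{F}_k=\sigma(x_0,y_0,M_i,M'_i,\ i\le k)$, $\mathbb{E}[M_{k+1}\mid\mathcal{F}_k]=0$, $\mathbb{E}[M'_{k+1}\mid\mathcal{F}_k]=0$ and, for some constant $\mathfrak{c}_2>0$, $\mathbb{E}[\|M_{k+1}\|^2+\|M'_{k+1}\|^2\mid\mathcal{F}_k]\le\mathfrak{c}_2(1+\|x_k\|^2+\|y_k\|^2)$ for all $k\ge0$. Step sizes: $\alpha_k=\alpha/(k+K_1)^{0.5+0.66\epsilon}$ and $\beta_k=\beta/(k+K_1)^{0.75+\epsilon}$ with constants $\alpha,\beta>0$ and $K_1\ge1$. *)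

(* Defs.v *)
From HB Require Import structures.
From mathcomp Require Export all_boot all_order all_algebra.
From mathcomp Require Export all_classical all_reals all_analysis.

Set Implicit Arguments.
Unset Strict Implicit.
Unset Printing Implicit Defensive.

Export Order.TTheory GRing.Theory Num.Theory.
Export numFieldNormedType.Exports.

Local Open Scope classical_set_scope.
Local Open Scope ring_scope.

(* The library norm `|x| on 'rV[R]_d is the sup norm, so the Euclidean norm is
   defined here. The topologies (hence nbhs, closed, differentiable) agree. *)
Definition dotr (R : realType) (d : nat) (u v : 'rV[R]_d) : R :=
  \sum_(i < d) u 0 i * v 0 i.

Definition enorm (R : realType) (d : nat) (u : 'rV[R]_d) : R :=
  Num.sqrt (dotr u u).

Definition enorm2 (R : realType) (d1 d2 : nat)
    (u : 'rV[R]_d1) (v : 'rV[R]_d2) : R :=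
  Num.sqrt (enorm u ^+ 2 + enorm v ^+ 2).

Definition bounded_diameter (R : realType) (d : nat) (X : set 'rV[R]_d) : Prop :=
  exists D : R, forall x x', X x -> X x' -> enorm (x - x') <= D.

(* The set P_X(v) = argmin_(x' in X) ||v - x'|| *)
Definition projection (R : realType) (d : nat) (X : set 'rV[R]_d)
    (v : 'rV[R]_d) : set 'rV[R]_d :=
  [set p | X p /\ forall x', X x' -> enorm (v - p) <= enorm (v - x')].

(* H is only meaningful on X * R^d2, so (gx, gy) is its Frechet gradient
   relative to that set: increments are taken inside X * R^d2 only. Where X is
   thin the relative gradient need not be unique; (gx, gy) is then any choice. *)
Definition gradient_on (R : realType) (d1 d2 : nat) (X : set 'rV[R]_d1)
    (H : 'rV[R]_d1 -> 'rV[R]_d2 -> R)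
    (gx : 'rV[R]_d1 -> 'rV[R]_d2 -> 'rV[R]_d1)
    (gy : 'rV[R]_d1 -> 'rV[R]_d2 -> 'rV[R]_d2) : Prop :=
  forall x y, X x -> forall e : R, 0 < e ->
    \forall z \near (x, y), X z.1 ->
      `|H z.1 z.2 - H x y - (dotr (gx x y) (z.1 - x) + dotr (gy x y) (z.2 - y))|
        <= e * enorm2 (z.1 - x) (z.2 - y).

Definition smooth_on (R : realType) (d1 d2 : nat) (X : set 'rV[R]_d1) (L : R)
    (H : 'rV[R]_d1 -> 'rV[R]_d2 -> R)
    (gx : 'rV[R]_d1 -> 'rV[R]_d2 -> 'rV[R]_d1)
    (gy : 'rV[R]_d1 -> 'rV[R]_d2 -> 'rV[R]_d2) : Prop :=
  gradient_on X H gx gy /\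
  forall x y x' y', X x -> X x' ->
    enorm2 (gx x y - gx x' y') (gy x y - gy x' y')
      <= L * enorm2 (x - x') (y - y').

Definition strongly_concave (R : realType) (d : nat) (X : set 'rV[R]_d)
    (rho : R) (f : 'rV[R]_d -> R) : Prop :=
  forall x x' (t : R), X x -> X x' -> 0 <= t <= 1 ->
    t * f x + (1 - t) * f x' + rho / 2 * t * (1 - t) * enorm (x - x') ^+ 2
      <= f (t *: x + (1 - t) *: x').

Definition saddle_points (R : realType) (d1 d2 : nat) (X : set 'rV[R]_d1)
    (H : 'rV[R]_d1 -> 'rV[R]_d2 -> R) : set ('rV[R]_d1 * 'rV[R]_d2) :=
  [set s | X s.1 /\
    forall x y, X x -> H x s.2 <= H s.1 s.2 /\ H s.1 s.2 <= H s.1 y].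

Definition distance_to (R : realType) (d1 d2 : nat)
    (S : set ('rV[R]_d1 * 'rV[R]_d2)) (x : 'rV[R]_d1) (y : 'rV[R]_d2) : R :=
  inf [set enorm2 (x - s.1) (y - s.2) | s in S].

(* Phi(y) = max_(x in X) H(x, y). The supremum is a maximum when X is compact
   and non-empty and H is continuous in x. *)
Definition max_value (R : realType) (d1 d2 : nat) (X : set 'rV[R]_d1)
    (H : 'rV[R]_d1 -> 'rV[R]_d2 -> R) (y : 'rV[R]_d2) : R :=
  sup [set H x y | x in X].

Definition gradient (R : realType) (d : nat) (f : 'rV[R]_d -> R)
    (y : 'rV[R]_d) : 'rV[R]_d :=
  \row_(j < d) 'D_(delta_mx 0 j) f y.

Definition random_vector (R : realType) (disp : measure_display)
    (T : measurableType disp) (d : nat) (Z : T -> 'rV[R]_d) : Prop :=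
  forall j : 'I_d, measurable_fun [set: T] (fun w => Z w 0 j).

Definition vector_events (R : realType) (T : Type) (d : nat)
    (Z : T -> 'rV[R]_d) : set_system T :=
  \bigcup_(j : 'I_d)
    preimage_set_system [set: T] (fun w => Z w 0 j) (@measurable _ R).

(* sigma(Z_0, W_0, M_i, N_i, 1 <= i <= k). The noise sequences start at index 1;
   M 0 and N 0 are never used. *)
Definition history (R : realType) (T : Type) (d1 d2 : nat)
    (Z0 : T -> 'rV[R]_d1) (W0 : T -> 'rV[R]_d2)
    (M : nat -> T -> 'rV[R]_d1) (N : nat -> T -> 'rV[R]_d2) (k : nat)
    : set_system T :=
  <<s vector_events Z0 `|` vector_events W0 `|`
      \bigcup_(i in [set i | (0 < i <= k)%N])
        (vector_events (M i) `|` vector_events (N i)) >>.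

(* Y is a version of the conditional expectation E[Z | F] *)
Definition is_cond_exp (R : realType) (disp : measure_display)
    (T : measurableType disp) (P : probability T R) (F : set_system T)
    (Z Y : T -> R) : Prop :=
  [/\ P.-integrable [set: T] (EFin \o Z),
      P.-integrable [set: T] (EFin \o Y),
      preimage_set_system [set: T] Y (@measurable _ R) `<=` F &
      forall A, F A ->
        (\int[P]_(w in A) (Y w)%:E = \int[P]_(w in A) (Z w)%:E)%E].

(* Main.v *)
From HB Require Import structures.
From mathcomp Require Import measurable_realfun ring lra.
Require Import Defs.

(* Strong concavity makes the best response x*(y) = argmax_X H(., y) Lipschitz, so that
   Phi is convex with Lipschitz gradient dPhi(y) = grad_y H(x*(y), y).  Three Lyapunov
   functions are followed: Y = |y_k - ybar|^2, Z = |x_k - x*(y_k)|^2 and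
   W = Phi(y_k) - min Phi.  In conditional mean, Z contracts at the fast rate a_k up to a
   forcing a_k^2 + b_k^2/a_k, and the error Z in turn perturbs the descent of Y and W.
   Y + Z is an almost supermartingale with summable forcing, whence bounded moments.
   For S = W + kappa (b_k/a_k) Z the contraction of Z pays for its perturbation of W:
     E S_{k+1} <= E S_k - b_k E(|dPhi|^2/2 + Z) + O(k^(-5/4)),
   and by convexity (E S)^2 = O(E|dPhi|^2 + E Z).  The resulting scalar recursion
   s' <= s - c b_k s^2 + O(k^(-5/4)) has the rate k^(-(1/4 - eps)), which bounds
   E|dPhi(y_k)|^2 <= 4 L' E W.  Almost sure convergence only needs Doob's maximal
   inequality: it gives sup Y < oo, and Z -> 0, S -> 0 because their means tend to 0
   (along a subsequence for Z).  Finally the saddle points are {xbar} x argmin Phi, and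
   Phi(y_k) -> min Phi along a bounded sequence forces y_k to approach argmin Phi. *)

Set Implicit Arguments.
Unset Strict Implicit.
Unset Printing Implicit Defensive.
Local Open Scope classical_set_scope.
Local Open Scope ring_scope.

(** * Euclidean vectors *)

(** [H] is only convex in [y], so W has no linear contraction: its descent is quadratic in the mean,
    and solving s' = - b s^2 with b of order k^(-(3/4 + eps)) is what fixes the exponent 1/4 - eps.
    The step exponents give a^2 and b^2/a the orders k^(-(1 + 1.32 eps)) and k^(-(1 + 1.34 eps)),
    both summable; multiplied by b/a they fall below k^(-5/4). No forcing series is ever summed: a
    summable forcing is dominated by the decrement of an explicit decreasing sequence, which plays
    the role of the tail in Gronwall's argument and in the maximal inequality. Conditional
    inequalities are stated between integrals over an arbitrary event A of the past. The whole space
    gives the means; the event that a level has not been reached gives Doob's inequality. The random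
    forcing, of size 1 + Y, is replaced by its full mean, so that it is deterministic once the
    moments are bounded. *)

Section EuclideanNorm.
Context {R : realType} {d : nat}.
Implicit Types u v w : 'rV[R]_d.

Lemma dotrC u v : dotr u v = dotr v u.
Proof. by apply: eq_bigr => i _; rewrite mulrC. Qed.

Lemma dotrDl u v w : dotr (u + v) w = dotr u w + dotr v w.
Proof. by rewrite -big_split; apply: eq_bigr => i _; rewrite mxE mulrDl. Qed.

Lemma dotrZl c u v : dotr (c *: u) v = c * dotr u v.
Proof. by rewrite mulr_sumr; apply: eq_bigr => i _; rewrite mxE mulrA. Qed.

Lemma dotrNl u v : dotr (- u) v = - dotr u v.
Proof. by rewrite -scaleN1r dotrZl mulN1r. Qed.

Lemma dotrDr u v w : dotr u (v + w) = dotr u v + dotr u w.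
Proof. by rewrite dotrC dotrDl !(dotrC u). Qed.

Lemma dotrZr c u v : dotr u (c *: v) = c * dotr u v.
Proof. by rewrite dotrC dotrZl dotrC. Qed.

Lemma dotrNr u v : dotr u (- v) = - dotr u v.
Proof. by rewrite dotrC dotrNl dotrC. Qed.

Lemma dotrBl u v w : dotr (u - v) w = dotr u w - dotr v w.
Proof. by rewrite dotrDl dotrNl. Qed.

Lemma dotrBr u v w : dotr u (v - w) = dotr u v - dotr u w.
Proof. by rewrite dotrDr dotrNr. Qed.

Lemma dotrr_ge0 u : 0 <= dotr u u.
Proof. by apply: sumr_ge0 => i _; rewrite -expr2 sqr_ge0. Qed.

Lemma enorm_ge0 u : 0 <= enorm u.
Proof. exact: sqrtr_ge0. Qed.

Lemma enorm_sqr u : enorm u ^+ 2 = dotr u u.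
Proof. by rewrite sqr_sqrtr// dotrr_ge0. Qed.

Lemma enormN u : enorm (- u) = enorm u.
Proof. by rewrite /enorm dotrNl dotrNr opprK. Qed.

Lemma enormB u v : enorm (u - v) = enorm (v - u).
Proof. by rewrite -enormN opprB. Qed.

Lemma enormZ c u : enorm (c *: u) = `|c| * enorm u.
Proof.
by rewrite /enorm dotrZl dotrZr mulrA -expr2 sqrtrM ?sqr_ge0// sqrtr_sqr.
Qed.

Lemma enorm_sqrZ c u : enorm (c *: u) ^+ 2 = c ^+ 2 * enorm u ^+ 2.
Proof. by rewrite enormZ exprMn real_normK// num_real. Qed.

Lemma enorm_sqrD u v :
  enorm (u + v) ^+ 2 = enorm u ^+ 2 + 2 * dotr u v + enorm v ^+ 2.
Proof.
by rewrite !enorm_sqr dotrDl !dotrDr (dotrC v u); ring.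
Qed.

Lemma ler_coord_enorm u j : `|u 0 j| <= enorm u.
Proof.
rewrite -(ler_pXn2r (n := 2)) ?nnegrE ?enorm_ge0// enorm_sqr real_normK ?num_real//.
rewrite /dotr (bigD1 j)//= expr2 lerDl.
by apply: sumr_ge0 => i _; rewrite -expr2 sqr_ge0.
Qed.

Lemma enorm_eq0 u : (enorm u == 0) = (u == 0).
Proof.
apply/idP/eqP => [/eqP u0|->].
  apply/rowP => j; apply/eqP; rewrite mxE -normr_le0.
  by rewrite (le_trans (ler_coord_enorm u j))// u0.
by rewrite -(scale0r (0 : 'rV[R]_d)) enormZ normr0 mul0r.
Qed.

Lemma enorm0 : enorm (0 : 'rV[R]_d) = 0.
Proof. by apply/eqP; rewrite enorm_eq0. Qed.

(** Cauchy-Schwarz, from [|B u - C v|^2 >= 0] with [B = |v|^2] and [C = <u, v>], divided by [B]. *)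
Lemma dotr_le u v : dotr u v <= enorm u * enorm v.
Proof.
have [->|v0] := eqVneq v 0.
  by rewrite enorm0 mulr0 -(scale0r (0 : 'rV[R]_d)) dotrZr mul0r.
have Bgt0 : 0 < enorm v ^+ 2 by rewrite exprn_gt0// lt_def enorm_eq0 v0 enorm_ge0.
have [Cle0|Cgt0] := leP (dotr u v) 0.
  by rewrite (le_trans Cle0)// mulr_ge0// enorm_ge0.
rewrite -(ler_pXn2r (n := 2)) ?nnegrE ?mulr_ge0 ?enorm_ge0 ?(ltW Cgt0)//.
have := dotrr_ge0 ((enorm v ^+ 2) *: u - dotr u v *: v).
rewrite !(dotrBl, dotrBr, dotrZl, dotrZr) (dotrC v u) -!enorm_sqr.
set B := enorm v ^+ 2; set A := enorm u ^+ 2; set C := dotr u v => h.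
rewrite exprMn -subr_ge0 -(pmulr_rge0 _ Bgt0) -/A -/B.
by apply: le_trans h _; rewrite le_eqVlt; apply/orP; left; apply/eqP; ring.
Qed.

Lemma normr_dotr u v : `|dotr u v| <= enorm u * enorm v.
Proof.
by rewrite ler_norml dotr_le andbT lerNl -dotrNl (le_trans (dotr_le _ _))// enormN.
Qed.

Lemma enormD u v : enorm (u + v) <= enorm u + enorm v.
Proof.
rewrite -(ler_pXn2r (n := 2)) ?nnegrE ?addr_ge0 ?enorm_ge0//.
by rewrite enorm_sqrD; have := dotr_le u v; nra.
Qed.

Lemma ler_dist_enorm u v : `|enorm u - enorm v| <= enorm (u - v).
Proof.
rewrite ler_norml; apply/andP; split.
  by rewrite lerNl opprB lerBlDr enormB -{1}(subrK u v) enormD.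
by rewrite lerBlDr -{1}(subrK v u) enormD.
Qed.

Lemma dotr_young c u v : 0 < c ->
  2 * dotr u v <= c * enorm u ^+ 2 + c^-1 * enorm v ^+ 2.
Proof.
move=> c0; have := dotrr_ge0 (c *: u - v).
rewrite !(dotrBl, dotrBr, dotrZl, dotrZr) (dotrC v u) -!enorm_sqr => h.
rewrite -(ler_pM2l c0) mulrDr mulrA mulVKf ?gt_eqF//.
by nra.
Qed.

Lemma enorm_sqrD_young c u v : 0 < c ->
  enorm (u + v) ^+ 2 <= (1 + c) * enorm u ^+ 2 + (1 + c^-1) * enorm v ^+ 2.
Proof. by move=> c0; rewrite enorm_sqrD; have := dotr_young u v c0; lra. Qed.

Lemma enorm_sqrD2 u v : enorm (u + v) ^+ 2 <= 2 * enorm u ^+ 2 + 2 * enorm v ^+ 2.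
Proof. by have := enorm_sqrD_young u v ltr01; rewrite invr1. Qed.

(** Together with [enorm_le_normr], the comparison that carries Euclidean estimates over to the
    balls of the library norm. *)
Lemma normr_le_enorm u : `|u| <= enorm u.
Proof.
rewrite /Num.norm /= mx_normrE; apply/bigmax_leP; split => [|[i j] _ /=].
  exact: enorm_ge0.
by rewrite (ord1 i) ler_coord_enorm.
Qed.

Lemma enorm_le_normr u : enorm u <= Num.sqrt d%:R * `|u|.
Proof.
rewrite -(ler_pXn2r (n := 2)) ?nnegrE ?mulr_ge0 ?enorm_ge0 ?sqrtr_ge0//.
rewrite exprMn enorm_sqr sqr_sqrtr// /dotr mulr_natl.
have -> : `|u| ^+ 2 *+ d = \sum_(i < d) `|u| ^+ 2 by rewrite sumr_const card_ord.
apply: ler_sum => i _; rewrite -expr2 -[leLHS]real_normK ?num_real//.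
rewrite ler_pXn2r ?nnegrE//.
rewrite [leRHS]/Num.norm /= mx_normrE.
by apply: (le_bigmax _ (fun ij => `|u ij.1 ij.2|) (0, i)).
Qed.

End EuclideanNorm.

Section ProductNorm.
Context {R : realType} {d1 d2 : nat}.
Implicit Types (u : 'rV[R]_d1) (v : 'rV[R]_d2).

Lemma dotr_row_mx u v u' v' :
  dotr (row_mx u v) (row_mx u' v') = dotr u u' + dotr v v'.
Proof.
rewrite /dotr big_split_ord /=; congr (_ + _); apply: eq_bigr => i _.
  by rewrite !row_mxEl.
by rewrite !row_mxEr.
Qed.

(** Reading the product norm as the norm of a concatenated row lets facts about [enorm] apply to
    pairs. *)
Lemma enorm2E u v : enorm2 u v = enorm (row_mx u v).
Proof. by rewrite /enorm2 !enorm_sqr -dotr_row_mx. Qed.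

Lemma enorm2_ge0 u v : 0 <= enorm2 u v.
Proof. exact: sqrtr_ge0. Qed.

Lemma enorm2_sqr u v : enorm2 u v ^+ 2 = enorm u ^+ 2 + enorm v ^+ 2.
Proof. by rewrite sqr_sqrtr// addr_ge0// sqr_ge0. Qed.

Lemma enorm2_le u v : enorm2 u v <= enorm u + enorm v.
Proof.
rewrite -(ler_pXn2r (n := 2)) ?nnegrE ?addr_ge0 ?enorm_ge0 ?enorm2_ge0//.
by rewrite enorm2_sqr; have := enorm_ge0 u; have := enorm_ge0 v; nra.
Qed.

Lemma enorm_le_enorm2l u v : enorm u <= enorm2 u v.
Proof.
rewrite -(ler_pXn2r (n := 2)) ?nnegrE ?enorm_ge0 ?enorm2_ge0//.
by rewrite enorm2_sqr lerDl sqr_ge0.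
Qed.

Lemma enorm_le_enorm2r u v : enorm v <= enorm2 u v.
Proof.
rewrite -(ler_pXn2r (n := 2)) ?nnegrE ?enorm_ge0 ?enorm2_ge0//.
by rewrite enorm2_sqr lerDr sqr_ge0.
Qed.

Lemma enorm2Z c u v : enorm2 (c *: u) (c *: v) = `|c| * enorm2 u v.
Proof. by rewrite !enorm2E -scale_row_mx enormZ. Qed.

End ProductNorm.

Ltac nonneg := solve [repeat first [assumption | by [] | by apply: ltW; assumption
  | exact: sqr_ge0 | exact: enorm_ge0 | exact: powR_ge0 | apply: addr_ge0 | apply: mulr_ge0
  | apply: exprn_ge0 | rewrite invr_ge0]].

(** * Convex sets and projections *)

Section Segments.
Context {R : realType}.

Lemma convex_set_segment (n : nat) (A : set 'rV[R]_n) u v (t : R) :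
  convex_set A -> A u -> A v -> 0 <= t <= 1 -> A (u + t *: (v - u)).
Proof.
move=> cA Au Av /andP[t0 t1].
have := cA v u (Itv01 t0 t1) (mem_set Av) (mem_set Au).
rewrite inE /conv/= => h; congr (A _): h.
by rewrite scalerBl scale1r scalerBr addrCA.
Qed.

Lemma convex_function_segment (n : nat) (f : 'rV[R]_n -> R) u v (t : R) :
  convex_function [set: 'rV[R]_n] f -> 0 <= t <= 1 ->
  f (u + t *: (v - u)) <= f u + t * (f v - f u).
Proof.
move=> cf /andP[t0 t1].
have h : f (t *: v + (1 - t) *: u) <= t * f v + (1 - t) * f u :=
  cf (Itv01 t0 t1) v u (mem_set I) (mem_set I).
have -> : u + t *: (v - u) = t *: v + (1 - t) *: u.
  by rewrite scalerBl scale1r scalerBr addrCA.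
lra.
Qed.

Lemma enorm_bounded_compact (n : nat) (A : set 'rV[R]_n) (D : R) (c : 'rV[R]_n) :
  closed A -> (forall u, A u -> enorm (u - c) <= D) -> compact A.
Proof.
move=> cA AD; apply: bounded_closed_compact => //.
exists (D + enorm c); split; first exact: num_real.
move=> r Dr u /AD uD /=; rewrite (le_trans (normr_le_enorm u))// ltW//.
apply: le_lt_trans Dr; rewrite -[u](subrK c) (le_trans (enormD _ _))//.
by rewrite lerD2r.
Qed.

Lemma enorm_within_continuous (n : nat) (A : set 'rV[R]_n) (f : 'rV[R]_n -> R) :
  (forall u, A u -> forall e, 0 < e -> exists2 r, 0 < r &
     forall v, A v -> enorm (v - u) < r -> `|f v - f u| <= e) ->
  {within A, continuous f}.
Proof.
move=> fA; apply/subspace_continuousP => u Au.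
apply/cvgrPdist_le => e e0; have [r r0 fr] := fA u Au e e0.
rewrite /within /=; apply/nbhs_ballP.
(* The added 1 keeps the constant positive in dimension 0. *)
pose K := Num.sqrt n%:R + 1 : R.
have K0 : 0 < K by rewrite ltr_wpDl ?sqrtr_ge0.
exists (r / K); first by rewrite /= divr_gt0.
move=> v; rewrite mx_norm_ball /ball_ /= => uv Av.
rewrite distrC; apply: fr => //.
rewrite (le_lt_trans (enorm_le_normr _))// -normrN opprB.
rewrite (le_lt_trans (y := K * `|u - v|))//.
  by rewrite ler_wpM2r// lerDl.
by rewrite mulrC -ltr_pdivlMr.
Qed.

Lemma lipschitz_argmax (n : nat) (A : set 'rV[R]_n) (f : 'rV[R]_n -> R) (K : R) :
  A !=set0 -> compact A ->
  (forall u v, A u -> A v -> `|f u - f v| <= K * enorm (u - v)) ->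
  exists2 c, A c & forall u, A u -> f u <= f c.
Proof.
move=> A0 cA fK.
have [|c cAc fc] := EVT_max_rV A0 cA (f := f).
  apply: enorm_within_continuous => u Au e e0.
  exists (e / (`|K| + 1)); first by rewrite divr_gt0// ltr_wpDl.
  move=> v Av vu; apply: le_trans (fK _ _ Av Au) _.
  rewrite (le_trans (y := (`|K| + 1) * enorm (v - u)))//.
    by rewrite ler_wpM2r ?enorm_ge0// ler_wpDr// ler_norm.
  by rewrite mulrC -ler_pdivlMr ?ltr_wpDl// ltW.
by exists c => [|u Au]; [exact/set_mem | apply: fc; exact/mem_set].
Qed.

Lemma projection_nonempty (n : nat) (A : set 'rV[R]_n) v (D : R) :
  A !=set0 -> closed A -> (forall u w, A u -> A w -> enorm (u - w) <= D) ->
  projection A v !=set0.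
Proof.
move=> [a Aa] cA AD.
have cpA : compact A.
  by apply: (@enorm_bounded_compact _ _ D a) => // u Au; exact: AD.
have [||c Ac cmax] := @lipschitz_argmax _ A (fun u => - enorm (v - u)) 1 _ cpA.
- by exists a.
- move=> u w _ _; rewrite mul1r opprK addrC (le_trans (ler_dist_enorm _ _))//.
  by rewrite opprB addrC addrA subrK enormB.
- by exists c; split=> // x' /cmax; rewrite lerN2.
Qed.

(** Extracts a first-order condition from a second-order comparison: letting [t] tend to 0 removes
    the remainder [t * q]. *)
Lemma le0_of_small (p q : R) :
  (forall t : R, 0 < t <= 1 -> p <= t * q) -> p <= 0.
Proof.
move=> h; rewrite leNgt; apply/negP => p0.
have q0 : 0 < q.
  by have := h 1; rewrite ltr01 lexx mul1r => /(_ isT); apply: lt_le_trans.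
(* The value [t = p / (2 (p + q))] is at most 1 and gives [t q < p]. *)
have pq : 0 < p / (p + q) / 2 by rewrite !divr_gt0// addr_gt0.
have := h (p / (p + q) / 2); rewrite pq /=.
have -> : p / (p + q) / 2 <= 1.
  by rewrite ler_pdivrMr// ler_pdivrMr ?addr_gt0//; lra.
move=> /(_ isT); rewrite leNgt => /negP; apply.
rewrite -mulrA mulrAC ltr_pdivrMr ?addr_gt0//.
nra.
Qed.

(** Moving from [p] towards [u] by a fraction [t] cannot come closer to [v]; expanding the square
    and dividing by [t] leaves a remainder of order [t]. *)
Lemma projection_variational (n : nat) (A : set 'rV[R]_n) v p u :
  convex_set A -> projection A v p -> A u -> dotr (v - p) (u - p) <= 0.
Proof.
move=> cA [Ap pmin] Au.
suff : 2 * dotr (v - p) (u - p) <= 0 by lra.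
apply: (@le0_of_small _ (enorm (u - p) ^+ 2)) => t /andP[t0 t1].
have := pmin _ (convex_set_segment cA Ap Au (t := t) _).
rewrite (ltW t0) t1 => /(_ isT).
rewrite -(ler_pXn2r (n := 2)) ?nnegrE ?enorm_ge0//.
rewrite opprD addrA (enorm_sqrD (v - p)) enormN enorm_sqrZ dotrNr dotrZr => h.
rewrite -(ler_pM2l t0); lra.
Qed.

Lemma projection_to (n : nat) (A : set 'rV[R]_n) v p u :
  convex_set A -> projection A v p -> A u -> enorm (p - u) ^+ 2 <= enorm (v - u) ^+ 2.
Proof.
move=> cA pv Au; have := projection_variational cA pv Au.
have -> : v - u = (v - p) + (p - u) by rewrite addrA subrK.
rewrite -(opprB p u) dotrNr => h; rewrite (enorm_sqrD (v - p)).
by have := sqr_ge0 (enorm (v - p)); lra.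
Qed.

(** Adding the variational inequalities at [p] and [q] gives [|p - q|^2 <= <v - w, p - q>], and
    Cauchy-Schwarz concludes. *)
Lemma projection_nonexpansive (n : nat) (A : set 'rV[R]_n) v w p q :
  convex_set A -> projection A v p -> projection A w q ->
  enorm (p - q) <= enorm (v - w).
Proof.
move=> cA pv qw.
have h1 := projection_variational cA pv qw.1.
have h2 := projection_variational cA qw pv.1.
have : enorm (p - q) ^+ 2 <= enorm (v - w) * enorm (p - q).
  apply: le_trans (dotr_le (v - w) (p - q)).
  rewrite enorm_sqr; move: h1 h2; rewrite !(dotrBl, dotrBr) (dotrC q p); lra.
have [->|pq] := eqVneq (enorm (p - q)) 0; first by rewrite enorm_ge0.
by rewrite expr2 ler_pM2r// lt_def pq enorm_ge0.
Qed.

Lemma projection_unique (n : nat) (A : set 'rV[R]_n) v p q :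
  convex_set A -> projection A v p -> projection A v q -> p = q.
Proof.
move=> cA pv qv; apply/eqP; rewrite -subr_eq0 -enorm_eq0 eq_le enorm_ge0 andbT.
by rewrite (le_trans (projection_nonexpansive cA pv qv))// subrr enorm0.
Qed.

(** The step of length [1 / (2 K)] along [- g] minimizes the quadratic upper bound and lowers it by
    [|g|^2 / (4 K)], yet cannot go below [m]. *)
Lemma descent_gradient_bound (n : nat) (f : 'rV[R]_n -> R) (y g : 'rV[R]_n) (K m : R) :
  0 < K -> (forall y', f y' <= f y + dotr g (y' - y) + K * enorm (y' - y) ^+ 2) ->
  (forall y', m <= f y') -> enorm g ^+ 2 <= 4 * K * (f y - m).
Proof.
move=> K0 fK fm; have := fK (y - (2 * K)^-1 *: g); have := fm (y - (2 * K)^-1 *: g).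
rewrite [y - _ - y]addrC addKr enormN enorm_sqrZ dotrNr dotrZr -enorm_sqr.
set N := enorm _ ^+ 2 => h1 h2.
have -> : N = 4 * K * ((2 * K)^-1 * N - K * ((2 * K)^-1 ^+ 2 * N)).
  by field; rewrite gt_eqF.
have K4 : 0 < 4 * K by lra.
by rewrite (ler_pM2l K4); lra.
Qed.

End Segments.

(** * Linear forms as differentials *)

Section DotrLinear.
Context {R : realType} {d : nat}.

Fact dotr_is_linear (g : 'rV[R]_d) : linear (dotr g : 'rV[R]_d -> R^o).
Proof. by move=> c u v; rewrite dotrDr dotrZr. Qed.

HB.instance Definition _ (g : 'rV[R]_d) :=
  GRing.isLinear.Build R 'rV[R]_d R^o _ (dotr g) (dotr_is_linear g).

Lemma dotr_continuous (g : 'rV[R]_d) : continuous (dotr g : 'rV[R]_d -> R^o).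
Proof.
apply/continuous_subspace_setT.
apply: (@enorm_within_continuous _ _ setT (dotr g)) => u _ e e0.
have K0 : 0 < enorm g + 1 by rewrite ltr_wpDl// enorm_ge0.
exists (e / (enorm g + 1)) => [|v _ vu]; first by rewrite divr_gt0.
rewrite -dotrBr (le_trans (normr_dotr _ _))//.
rewrite (le_trans (y := (enorm g + 1) * enorm (v - u)))//.
  by rewrite ler_wpM2r ?enorm_ge0// lerDl.
by rewrite mulrC -ler_pdivlMr// ltW.
Qed.

(** A quadratic remainder is [o(h)], so [dotr g] is the differential by uniqueness; its values on
    the basis vectors are the coordinates of [g]. *)
Lemma quadratic_remainder_differentiable (f : 'rV[R]_d -> R) (y g : 'rV[R]_d) (K : R) :
  (forall h, `|f (h + y) - f y - dotr g h| <= K * enorm h ^+ 2) ->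
  differentiable f y /\ gradient f y = g.
Proof.
move=> fK.
have dfE : f \o shift y = cst (f y) + (dotr g : 'rV[R]_d -> R^o) +o_ (0 : 'rV[R]_d) id.
  apply/eqaddoP => e e0; apply/nbhs_ballP.
  (* Converts [K] times the squared Euclidean norm into a positive multiple of the squared sup
     norm. *)
  pose C := (`|K| + 1) * (Num.sqrt d%:R + 1) ^+ 2.
  have C0 : 0 < C by rewrite mulr_gt0 ?exprn_gt0// ltr_wpDl// sqrtr_ge0.
  exists (e / C); first by rewrite /= divr_gt0.
  move=> h; rewrite mx_norm_ball /ball_ /= sub0r normrN => hC.
  rewrite !fctE /= opprD addrA; apply: le_trans (fK h) _.
  have hn : enorm h <= (Num.sqrt d%:R + 1) * `|h|.
    by rewrite (le_trans (enorm_le_normr h))// ler_wpM2r// lerDl.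
  apply: (@le_trans _ _ (C * `|h| * `|h|)).
    rewrite /C -!mulrA -!expr2 (le_trans (ler_wpM2r (sqr_ge0 _) (y := `|K| + 1) _))//.
      by rewrite ler_wpDr// ler_norm.
    rewrite ler_wpM2l ?addr_ge0//.
    by rewrite mulrA -expr2 -exprMn ler_pXn2r ?nnegrE ?mulr_ge0 ?enorm_ge0// addr_ge0// sqrtr_ge0.
  by rewrite ler_wpM2r// mulrC -ler_pdivlMr// ltW.
have dE : 'd f y = dotr g :> ('rV[R]_d -> R^o).
  by apply: diff_unique => //; exact: dotr_continuous.
have df : differentiable f y.
  by apply/diff_locallyP; rewrite dE; split => //; exact: dotr_continuous.
split => //; apply/rowP => j; rewrite mxE deriveE// dE.
rewrite /dotr (bigD1 j)//= mxE !eqxx mulr1 big1 ?addr0// => i ij.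
by rewrite mxE (negbTE ij) andbF mulr0.
Qed.
End DotrLinear.

(** * Best response and max function *)

Section ConcaveConvex.
Context {R : realType} {d1 d2 : nat} (X : set 'rV[R]_d1)
  (H : 'rV[R]_d1 -> 'rV[R]_d2 -> R)
  (gx : 'rV[R]_d1 -> 'rV[R]_d2 -> 'rV[R]_d1)
  (gy : 'rV[R]_d1 -> 'rV[R]_d2 -> 'rV[R]_d2) (L rho : R)
  (X_nonempty : X !=set0) (X_closed : closed X) (X_convex : convex_set X)
  (X_bounded : bounded_diameter X)
  (L_gt0 : 0 < L) (rho_gt0 : 0 < rho)
  (H_smooth : smooth_on X L H gx gy)
  (H_concave : forall y, strongly_concave X rho (fun x => H x y))
  (H_convex : forall x, X x -> convex_function [set: 'rV[R]_d2] (H x)).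
Implicit Types (x : 'rV[R]_d1) (y : 'rV[R]_d2).

(** The gradient is relative to [X] times the whole space, so it is only used along segments, which
    convexity keeps inside this set. This is its single point of entry for the first-order
    inequalities below. *)
Lemma segment_expansion x x' y y' e : X x -> X x' -> 0 < e ->
  exists2 t0, 0 < t0 <= 1 & forall t, 0 <= t <= t0 ->
    `|H (x + t *: (x' - x)) (y + t *: (y' - y)) - H x y
      - t * (dotr (gx x y) (x' - x) + dotr (gy x y) (y' - y))| <= e * t.
Proof.
move=> Xx Xx' e0; pose K := 1 + enorm2 (x' - x) (y' - y).
have K0 : 0 < K by rewrite ltr_wpDr// enorm2_ge0.
have [+ _] := H_smooth => /(_ x y Xx (e / K) (divr_gt0 e0 K0)).
move=> /nbhs_ballP[r /= r0 hr].
(* The bound 1 keeps the point on the segment; the other one keeps both components strictly inside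
   the ball of radius [r], since [K] dominates both displacements. *)
exists (Num.min 1 (r / 2 / K)).
  by rewrite ge_min lexx /= lt_min ltr01/= !divr_gt0.
move=> t /andP[t0]; rewrite le_min => /andP[t1 tr].
have small (n : nat) (v w : 'rV[R]_n) : enorm (v - w) <= K -> ball w r (w + t *: (v - w)).
  move=> vwK; rewrite mx_norm_ball /ball_ /= opprD addrA subrr add0r normrN.
  rewrite (le_lt_trans (normr_le_enorm _))// enormZ ger0_norm//.
  rewrite (le_lt_trans (y := r / 2))//; last by lra.
  rewrite (le_trans (ler_wpM2l t0 vwK))//.
  by rewrite -ler_pdivlMr.
have hb : ball (x, y) r (x + t *: (x' - x), y + t *: (y' - y)).
  split => /=; apply: small.
    by rewrite (le_trans (enorm_le_enorm2l _ (y' - y)))// lerDr.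
  by rewrite (le_trans (enorm_le_enorm2r (x' - x) _))// lerDr.
have hX : X (x + t *: (x' - x)) by apply: convex_set_segment => //; rewrite t0.
have /= := hr _ hb hX.
rewrite ![_ + _ *: _ - _]addrC !addKr !dotrZr -mulrDr => h.
apply: le_trans h _; rewrite enorm2Z ger0_norm// mulrA mulrAC.
by rewrite ler_wpM2r// mulrAC ler_pdivrMr// ler_pM2l// lerDr.
Qed.


(** First-order form of strong concavity: the definition at a small [t] is compared with the
    expansion along the segment and divided by [t]. *)
Lemma concave_upper x x' y : X x -> X x' ->
  H x' y <= H x y + dotr (gx x y) (x' - x) - rho / 2 * enorm (x - x') ^+ 2.
Proof.
move=> Xx Xx'; apply/ler_addgt0Pr => e e0.
have e20 : 0 < e / 2 by rewrite divr_gt0.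
have [t0 /andP[t00 t01] ht] := segment_expansion y y Xx Xx' e20.
set n2 := enorm (x - x') ^+ 2; have n20 : 0 <= n2 := sqr_ge0 _.
have rn : 0 <= rho * n2 by rewrite mulr_ge0// ltW.
(* The second bound makes the factor [1 - t] of the strong concavity term cost at most [e / 2]; the
   expansion costs the other half. *)
pose t := Num.min t0 (e / (rho * n2 + 1)).
have tgt0 : 0 < t by rewrite lt_min t00 divr_gt0// ltr_wpDl.
have tt0 : t <= t0 by rewrite ge_min lexx.
have tsmall : t * (rho * n2) <= e.
  have : t <= e / (rho * n2 + 1) by rewrite ge_min lexx orbT.
  by rewrite ler_pdivlMr ?ltr_wpDl//; nra.
have := ht t; rewrite (ltW tgt0) tt0 => /(_ isT).
rewrite subrr scaler0 addr0 -(scale0r (0 : 'rV[R]_d2)) dotrZr mul0r addr0.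
rewrite ler_norml => /andP[_ hup].
have := H_concave y (t := t) Xx' Xx; rewrite (ltW tgt0) (le_trans tt0 t01).
move=> /(_ isT); rewrite enormB -/n2.
have -> : t *: x' + (1 - t) *: x = x + t *: (x' - x).
  by rewrite scalerBl scale1r scalerBr addrCA.
move=> hlo.
have : t * (H x' y - H x y + rho / 2 * (1 - t) * n2 - dotr (gx x y) (x' - x) - e / 2) <= 0.
  by lra.
by rewrite pmulr_rle0//; lra.
Qed.

Lemma convex_lower x y y' : X x ->
  H x y + dotr (gy x y) (y' - y) <= H x y'.
Proof.
move=> Xx; apply/ler_addgt0Pr => e e0.
have [t /andP[t0 t1] ht] := segment_expansion y y' Xx Xx e0.
have := ht t; rewrite (ltW t0) lexx => /(_ isT).
rewrite subrr scaler0 addr0 -(scale0r (0 : 'rV[R]_d1)) dotrZr mul0r add0r.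
rewrite ler_norml => /andP[hlo _].
have := convex_function_segment y y' (t := t) (H_convex Xx).
rewrite (ltW t0) t1 => /(_ isT) hup.
have : t * (H x y + dotr (gy x y) (y' - y) - H x y' - e) <= 0 by lra.
by rewrite pmulr_rle0//; lra.
Qed.

Lemma maximizer_variational x x' y :
  X x -> (forall u, X u -> H u y <= H x y) -> X x' -> dotr (gx x y) (x' - x) <= 0.
Proof.
move=> Xx xmax Xx'; apply/ler_addgt0Pr => e e0; rewrite add0r.
have [t /andP[t0 t1] ht] := segment_expansion y y Xx Xx' e0.
have := ht t; rewrite (ltW t0) lexx => /(_ isT).
rewrite subrr scaler0 addr0 -(scale0r (0 : 'rV[R]_d2)) dotrZr mul0r addr0.
rewrite ler_norml => /andP[hlo _].
have := xmax _ (convex_set_segment X_convex Xx Xx' (t := t) _).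
rewrite (ltW t0) t1 => /(_ isT) hup.
have : t * (dotr (gx x y) (x' - x) - e) <= 0 by lra.
by rewrite pmulr_rle0//; lra.
Qed.

Lemma gx_lipschitz x y x' y' : X x -> X x' ->
  enorm (gx x y - gx x' y') <= L * enorm2 (x - x') (y - y').
Proof.
by move=> Xx Xx'; apply: le_trans (H_smooth.2 _ _ _ _ Xx Xx'); exact: enorm_le_enorm2l.
Qed.

Lemma gy_lipschitz x y x' y' : X x -> X x' ->
  enorm (gy x y - gy x' y') <= L * enorm2 (x - x') (y - y').
Proof.
by move=> Xx Xx'; apply: le_trans (H_smooth.2 _ _ _ _ Xx Xx'); exact: enorm_le_enorm2r.
Qed.

Lemma enorm2_0l y : enorm2 (0 : 'rV[R]_d1) y = enorm y.
Proof. by rewrite /enorm2 enorm0 expr0n add0r sqrtr_sqr ger0_norm ?enorm_ge0. Qed.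

Lemma enorm2_0r x : enorm2 x (0 : 'rV[R]_d2) = enorm x.
Proof. by rewrite /enorm2 enorm0 expr0n addr0 sqrtr_sqr ger0_norm ?enorm_ge0. Qed.

(** The gradient in [x] is bounded on the bounded set [X], so by [concave_upper] the function is
    Lipschitz there, and [X] is compact. *)
Lemma maximizer_exists y :
  exists x, X x /\ forall u, X u -> H u y <= H x y.
Proof.
have [x0 Xx0] := X_nonempty; have [D XD] := X_bounded.
have cX : compact X.
  by apply: (@enorm_bounded_compact _ _ _ D x0) => // u Xu; exact: XD.
have gK u : X u -> enorm (gx u y) <= enorm (gx x0 y) + L * D.
  move=> Xu; rewrite -[gx u y](subrK (gx x0 y)) addrC (le_trans (enormD _ _))// lerD2l.
  apply: le_trans (gx_lipschitz y y Xu Xx0) _.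
  by rewrite subrr enorm2_0r ler_pM2l// XD.
have [|x Xx xmax] := @lipschitz_argmax _ _ X (H^~ y) (enorm (gx x0 y) + L * D) X_nonempty cX.
  have half u v : X u -> X v -> H u y - H v y <= (enorm (gx x0 y) + L * D) * enorm (u - v).
    move=> Xu Xv; have := concave_upper y Xv Xu; have := dotr_le (gx v y) (u - v).
    have := ler_wpM2r (enorm_ge0 (u - v)) (gK _ Xv).
    have : 0 <= rho / 2 * enorm (v - u) ^+ 2.
      by rewrite mulr_ge0 ?sqr_ge0 ?divr_ge0// ltW.
    lra.
  move=> u v Xu Xv; rewrite ler_norml half// andbT lerNl opprB enormB.
  exact: half.
by exists x.
Qed.

(** An arbitrary choice of maximizer, which [best_response_unique] shows to be the only one. *)
Definition best_response y : 'rV[R]_d1 := projT1 (cid (maximizer_exists y)).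

Lemma best_response_in y : X (best_response y).
Proof. by rewrite /best_response; case: cid => ? []. Qed.

Lemma best_responseP y u : X u -> H u y <= H (best_response y) y.
Proof. by rewrite /best_response; case: cid => ? [? h] /=; exact: h. Qed.

Local Notation xs := best_response.
Hint Resolve best_response_in : core.

(** Adds strong concavity at [x] and at the maximizer, where the gradient term has a sign by
    optimality. This is the source of the contraction of Z. *)
Lemma strong_monotonicity x y : X x ->
  dotr (gx x y) (x - xs y) <= - rho * enorm (x - xs y) ^+ 2.
Proof.
move=> Xx.
have h1 := concave_upper y Xx (best_response_in y).
have h2 := concave_upper y (best_response_in y) Xx.
have h3 := maximizer_variational (best_response_in y) (@best_responseP y) Xx.
move: h1; rewrite -(opprB x (xs y)) dotrNr.
rewrite [enorm (xs y - x)]enormB in h2; lra.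
Qed.

Lemma best_response_unique x y :
  X x -> (forall u, X u -> H u y <= H x y) -> x = xs y.
Proof.
move=> Xx xmax; apply/eqP; rewrite -subr_eq0 -enorm_eq0 -sqrf_eq0 eq_le sqr_ge0 andbT.
have h1 := concave_upper y (best_response_in y) Xx.
have h3 := maximizer_variational (best_response_in y) (@best_responseP y) Xx.
have h4 := xmax _ (best_response_in y).
rewrite [enorm (xs y - x)]enormB in h1.
by rewrite -(pmulr_rle0 _ rho_gt0); lra.
Qed.

(** Strong monotonicity for [y] at the point [xs y'], against optimality of that point for [y']:
    only the change of gradient from [y'] to [y] remains, which is at most [L |y - y'|]. *)
Lemma best_response_lipschitz y y' :
  enorm (xs y - xs y') <= L / rho * enorm (y - y').
Proof.
have h1 := strong_monotonicity y (best_response_in y').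
have h2 := maximizer_variational (best_response_in y') (@best_responseP y') (best_response_in y).
have h3 := dotr_le (gx (xs y') y' - gx (xs y') y) (xs y' - xs y).
have h4 := gx_lipschitz y' y (best_response_in y') (best_response_in y').
rewrite subrr enorm2_0l [enorm (y' - y)]enormB in h4.
rewrite [enorm (xs y' - xs y)]enormB in h1 h3.
set n := enorm (xs y - xs y') in h1 h3 *; set m := enorm (y - y') in h4 *.
have h5 : rho * n ^+ 2 <= L * m * n.
  have := ler_wpM2r (enorm_ge0 (xs y - xs y')) h4; rewrite -/n => h6.
  move: h3 h2; rewrite dotrBl -(opprB (xs y') (xs y)) dotrNr; lra.
have [->|n0] := eqVneq n 0; first by rewrite !mulr_ge0 ?enorm_ge0 ?invr_ge0// ltW.
have ngt0 : 0 < n by rewrite lt_def n0 enorm_ge0.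
rewrite mulrAC ler_pdivlMr//.
by rewrite -(ler_pM2r ngt0); lra.
Qed.

Definition phi y : R := H (xs y) y.
(** Danskin's formula for the gradient of the max function, justified by [phi_differentiable]. *)
Definition dphi y : 'rV[R]_d2 := gy (xs y) y.
(** The factor [1 + L / rho] is a Lipschitz constant of [y |-> (xs y, y)], along which [gy] is
    evaluated. *)
Definition Lphi : R := L * (1 + L / rho).

Lemma Lphi_gt0 : 0 < Lphi.
Proof. by rewrite mulr_gt0// ltr_wpDr// divr_ge0// ltW. Qed.

Lemma max_value_phi y : max_value X H y = phi y.
Proof.
apply/eqP; rewrite eq_le; apply/andP; split.
  apply: ge_sup; first by exists (H (xs y) y), (xs y).
  by move=> _ [u Xu <-]; exact: best_responseP.
apply: ub_le_sup; last by exists (xs y).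
by exists (phi y) => _ [u Xu <-]; exact: best_responseP.
Qed.

Lemma dphi_lipschitz y y' : enorm (dphi y - dphi y') <= Lphi * enorm (y - y').
Proof.
apply: le_trans (gy_lipschitz y y' (best_response_in y) (best_response_in y')) _.
rewrite /Lphi -mulrA ler_pM2l//; apply: le_trans (enorm2_le _ _) _.
by rewrite mulrDl mul1r addrC lerD2l best_response_lipschitz.
Qed.

(** The convex function [H (xs y)] is a minorant of [phi] that touches it at [y]. *)
Lemma phi_lower y y' : phi y + dotr (dphi y) (y' - y) <= phi y'.
Proof.
by apply: le_trans (best_responseP y' (best_response_in y)); exact: convex_lower.
Qed.

(** Convexity is applied at [y'] and the gradient is moved back to [y] by its Lipschitz bound; this
    avoids integration and gives the constant [Lphi] in place of its half. *)
Lemma phi_upper y y' :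
  phi y' <= phi y + dotr (dphi y) (y' - y) + Lphi * enorm (y' - y) ^+ 2.
Proof.
have h1 := phi_lower y' y.
have h2 := dotr_le (dphi y' - dphi y) (y' - y).
have h3 := ler_wpM2r (enorm_ge0 (y' - y)) (dphi_lipschitz y' y).
move: h1 h2; rewrite dotrBl -(opprB y' y) dotrNr; lra.
Qed.

Lemma phi_differentiable y :
  differentiable (max_value X H) y /\ gradient (max_value X H) y = dphi y.
Proof.
have -> : max_value X H = phi by apply/funext => z; exact: max_value_phi.
apply: (@quadratic_remainder_differentiable _ _ _ _ _ Lphi) => h.
have := phi_upper y (h + y); have := phi_lower y (h + y); rewrite addrK => h1 h2.
have h3 : 0 <= Lphi * enorm h ^+ 2 by rewrite mulr_ge0 ?sqr_ge0// ltW// Lphi_gt0.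
by rewrite ler_norml; apply/andP; split; lra.
Qed.

Lemma phi_continuous : continuous phi.
Proof.
apply/continuous_subspace_setT/enorm_within_continuous => y _ e e0.
pose K := Lphi + enorm (dphi y) + 1.
have L0 := Lphi_gt0; have g0 := enorm_ge0 (dphi y).
have K0 : 0 < K by rewrite /K; lra.
exists (Num.min 1 (e / K)) => [|v _]; first by rewrite lt_min ltr01 divr_gt0.
rewrite lt_min ltr_pdivlMr// => /andP[v1 ve].
have := phi_upper y v; have := phi_lower y v.
have := normr_dotr (dphi y) (v - y); rewrite ler_norml => /andP[h1 h2].
set n := enorm (v - y) in v1 ve h1 h2 *; have n0 : 0 <= n := enorm_ge0 _.
move=> h3 h4.
have h5 : Lphi * n ^+ 2 <= Lphi * n by rewrite ler_pM2l// expr2 ler_piMr// ltW.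
rewrite ler_norml; rewrite /K in ve; apply/andP; split; nra.
Qed.

Lemma dphi_sqr_le y m : (forall y', m <= phi y') ->
  enorm (dphi y) ^+ 2 <= 4 * Lphi * (phi y - m).
Proof. by move=> hm; exact: descent_gradient_bound Lphi_gt0 (phi_upper y) hm. Qed.

(** * Saddle points, minimizers of the max function, growth of the gradients *)

Section SaddlePoint.
Context (xb : 'rV[R]_d1) (yb : 'rV[R]_d2) (saddle : saddle_points X H (xb, yb)).

Lemma saddle_in : X xb.
Proof. by case: saddle. Qed.

Lemma saddle_best_response : xb = xs yb.
Proof.
by apply: best_response_unique saddle_in _ => u Xu; case: saddle => _ /(_ u yb Xu)[].
Qed.

Lemma saddle_min y : phi yb <= phi y.
Proof.
rewrite /phi -saddle_best_response.
have [Xxb /(_ xb y Xxb)[_ h]] := saddle.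
exact: le_trans h (best_responseP y Xxb).
Qed.

Lemma dphi_saddle : dphi yb = 0.
Proof.
apply/eqP; rewrite -enorm_eq0 -sqrf_eq0 eq_le sqr_ge0 andbT.
by rewrite (le_trans (dphi_sqr_le yb saddle_min))// subrr mulr0.
Qed.

(* By minimax equality the saddle points are exactly {xb} x argmin phi. *)
Lemma argmin_saddle y : (forall y', phi y <= phi y') ->
  saddle_points X H (xb, y) /\ xs y = xb.
Proof.
move=> ymin; have [Xxb sad] := saddle.
have e1 : phi y = phi yb by apply/eqP; rewrite eq_le ymin saddle_min.
have e2 : H xb yb = phi yb by rewrite /phi -saddle_best_response.
have hy z : phi yb <= H xb z by rewrite -e2; case: (sad _ z Xxb).
have e3 : H xb y = phi y.
  by apply/eqP; rewrite eq_le best_responseP// e1 hy.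
have xbE : xb = xs y.
  by apply: best_response_unique => // u Xu; rewrite e3 best_responseP.
split => //; split => //= u z Xu; split; first by rewrite e3 best_responseP.
by rewrite e3 e1.
Qed.

(** The points of the ball at distance at least [e] from every minimizer form a compact set without
    minimizers, so [phi] exceeds its minimum there by a fixed [eta]. Outside a ball no such [eta]
    need exist, hence the radius [r]. *)
Lemma phi_small_argmin r e : 0 < e -> exists2 eta, 0 < eta &
  forall y, enorm (y - yb) <= r -> phi y - phi yb < eta ->
    exists2 y', (forall z, phi y' <= phi z) & enorm (y - y') < e.
Proof.
move=> e0.
pose K := [set y | enorm (y - yb) <= r] `&`
  \bigcap_(y' in [set y' | forall z, phi y' <= phi z]) [set y | e <= enorm (y - y')].
have enormc (c : 'rV[R]_d2) : continuous (fun y : 'rV[R]_d2 => enorm (y - c)).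
  apply/continuous_subspace_setT/enorm_within_continuous => y _ e' e'0.
  exists e' => // v _ vy; rewrite (le_trans (ler_dist_enorm _ _))// ltW//.
  by rewrite opprB addrA subrK.
have K_closed : closed K.
  apply: closedI; first exact: (closed_comp (fun y _ => enormc yb y) (@closed_le R r)).
  apply: closed_bigI => y' _.
  exact: (closed_comp (fun y _ => enormc y' y) (@closed_ge R e)).
have K_compact : compact K.
  by apply: (@enorm_bounded_compact _ _ _ r yb K_closed) => u [].
have [K0|Kn0] := pselect (K !=set0).
  have [c /set_mem cK cmin] := EVT_min_rV K0 K_compact (continuous_subspaceT phi_continuous).
  have cgt : phi yb < phi c.
    rewrite lt_neqAle saddle_min andbT; apply/eqP => ce.
    have := cK.2 c; rewrite /= subrr enorm0 leNgt e0 => /(_ _)/negP; apply => // z.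
    by rewrite -ce saddle_min.
  exists (phi c - phi yb) => [|y yr yc]; first by rewrite subr_gt0.
  apply: contrapT => h; have yK : K y.
    split => // y' /= y'min; rewrite leNgt; apply/negP => ye.
    by apply: h; exists y'.
  by have := cmin y (mem_set yK); rewrite leNgt => /negP; apply; lra.
exists 1 => // y yr _; apply: contrapT => h; apply: Kn0; exists y; split => // y' /= y'min.
by rewrite leNgt; apply/negP => ye; apply: h; exists y'.
Qed.

(** The gradients are Lipschitz and [X] is bounded, so drift and noise variance can all be measured
    against [1 + Y], without [x]. *)
Lemma growth_bound : exists2 C, 1 <= C & forall x y, X x ->
  [/\ enorm (gx x y) ^+ 2 <= C * (1 + enorm (y - yb) ^+ 2),
      enorm (gy x y) ^+ 2 <= C * (1 + enorm (y - yb) ^+ 2) &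
      1 + enorm x ^+ 2 + enorm y ^+ 2 <= C * (1 + enorm (y - yb) ^+ 2)].
Proof.
have [D XD] := X_bounded.
pose C := 2 * L ^+ 2 * (1 + D ^+ 2) + 2 * enorm (gx xb yb) ^+ 2
  + 2 * enorm (gy xb yb) ^+ 2 + 1 + 2 * D ^+ 2 + 2 * enorm xb ^+ 2
  + 2 * enorm yb ^+ 2 + 2.
have sq n (v : 'rV[R]_n) : 0 <= enorm v ^+ 2 := sqr_ge0 _.
have L2 : 0 <= L ^+ 2 := sqr_ge0 _; have D2 : 0 <= D ^+ 2 := sqr_ge0 _.
have LD : 0 <= L ^+ 2 * D ^+ 2 by rewrite mulr_ge0.
exists C => [|x y Xx].
  rewrite /C; have := sq _ (gx xb yb); have := sq _ (gy xb yb).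
  have := sq _ xb; have := sq _ yb; lra.
have Xxb := saddle_in.
have xD : enorm (x - xb) ^+ 2 <= D ^+ 2.
  have := XD _ _ Xx Xxb => h; rewrite ler_pXn2r ?nnegrE ?enorm_ge0//.
  by rewrite (le_trans _ h)// enorm_ge0.
set Y := enorm (y - yb) ^+ 2; have Y0 : 0 <= Y := sq _ _.
have pm u : 0 <= u -> 0 <= u * Y by move=> u0; rewrite mulr_ge0.
have LDY : L ^+ 2 * enorm2 (x - xb) (y - yb) ^+ 2 <= L ^+ 2 * (D ^+ 2 + Y).
  by rewrite enorm2_sqr ler_wpM2l// lerD2r.
have p1 := pm _ L2; have p2 := pm _ LD; have p3 := pm _ (sq _ (gx xb yb)).
have p4 := pm _ (sq _ (gy xb yb)); have p5 := pm _ D2.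
have p6 := pm _ (sq _ xb); have p7 := pm _ (sq _ yb).
have q1 := sq _ (gx xb yb); have q2 := sq _ (gy xb yb).
have q3 := sq _ xb; have q4 := sq _ yb.
have nn : 0 <= L * enorm2 (x - xb) (y - yb) by rewrite mulr_ge0 ?enorm2_ge0// ltW.
split.
- have := enorm_sqrD2 (gx x y - gx xb yb) (gx xb yb); rewrite subrK => h.
  have : enorm (gx x y - gx xb yb) ^+ 2 <= L ^+ 2 * enorm2 (x - xb) (y - yb) ^+ 2.
    by rewrite -exprMn ler_pXn2r ?nnegrE ?enorm_ge0// gx_lipschitz.
  rewrite /C; lra.
- have := enorm_sqrD2 (gy x y - gy xb yb) (gy xb yb); rewrite subrK => h.
  have : enorm (gy x y - gy xb yb) ^+ 2 <= L ^+ 2 * enorm2 (x - xb) (y - yb) ^+ 2.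
    by rewrite -exprMn ler_pXn2r ?nnegrE ?enorm_ge0// gy_lipschitz.
  rewrite /C; lra.
- have := enorm_sqrD2 (x - xb) xb; have := enorm_sqrD2 (y - yb) yb.
  rewrite !subrK -/Y => h1 h2; rewrite /C; lra.
Qed.

(** The nearby saddle point is [(xb, y')] with [y'] a minimizer close to [y_k]; since [xs y' = xb],
    the first component is reached through [xs (y_k)]. *)
Lemma distance_to_saddle_cvg0 (xk : nat -> 'rV[R]_d1) (yk : nat -> 'rV[R]_d2) :
  (exists K, forall k, enorm (yk k - yb) ^+ 2 <= K) ->
  enorm (xk k - xs (yk k)) ^+ 2 @[k --> \oo] --> (0 : R) ->
  phi (yk k) - phi yb @[k --> \oo] --> (0 : R) ->
  distance_to (saddle_points X H) (xk k) (yk k) @[k --> \oo] --> (0 : R).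
Proof.
move=> [K yK] /cvgrPdist_lt xc /cvgrPdist_lt yc; apply/cvgrPdist_lt => e e0.
have Lr0 : 0 <= L / rho by rewrite divr_ge0// ltW.
(* One unit for [|x_k - xs (y_k)|], one for [|y_k - y'|], and [L / rho] for the displacement of the
   best response. *)
pose c := 2 + L / rho; have c0 : 0 < c by rewrite /c; lra.
have ec : 0 < e / c by rewrite divr_gt0.
have yK' k : enorm (yk k - yb) <= 1 + K.
  by have := yK k; have := sqr_ge0 (enorm (yk k - yb) - 1); nra.
have [eta eta0 heta] := phi_small_argmin (1 + K) ec.
have := xc ((e / c) ^+ 2) (exprn_gt0 2 ec); have := yc eta eta0.
apply: filterS2 => k hy hx.
rewrite sub0r normrN ger0_norm ?subr_ge0 ?saddle_min// in hy.
rewrite sub0r normrN ger0_norm ?sqr_ge0// ltr_pXn2r ?nnegrE ?enorm_ge0 ?(ltW ec)// in hx.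
set dk := distance_to _ _ _.
have [y' y'min y'e] := heta (yk k) (yK' k) hy.
have [sad xsE] := argmin_saddle y'min.
pose D := [set enorm2 (xk k - s.1) (yk k - s.2) | s in saddle_points X H].
have Dlb : lbound D 0 by move=> _ [s _ <-]; exact: enorm2_ge0.
have Dle : dk <= enorm2 (xk k - xb) (yk k - y').
  by apply: ge_inf; [exists 0 | exists (xb, y')].
have D0 : 0 <= dk.
  by apply: lb_le_inf => //; exists (enorm2 (xk k - xb) (yk k - y')), (xb, y').
rewrite distrC subr0 ger0_norm//; apply: le_lt_trans Dle _; apply: le_lt_trans (enorm2_le _ _) _.
have h1 : enorm (xk k - xb) <= enorm (xk k - xs (yk k)) + L / rho * enorm (yk k - y').
  rewrite -{1}(subrK (xs (yk k)) (xk k)) -addrA (le_trans (enormD _ _))// lerD2l.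
  by rewrite -xsE best_response_lipschitz.
have h2 : L / rho * enorm (yk k - y') <= L / rho * (e / c) by rewrite ler_wpM2l// ltW.
have h3 : e = c * (e / c) by rewrite mulrCA divff ?mulr1// gt_eqF.
by move: h3; rewrite {1}/c; lra.
Qed.

End SaddlePoint.

End ConcaveConvex.

(** * Pathwise Lyapunov inequalities *)

Section OneStep.
Context {R : realType} {d1 d2 : nat} (X : set 'rV[R]_d1)
  (gx : 'rV[R]_d1 -> 'rV[R]_d2 -> 'rV[R]_d1)
  (gy : 'rV[R]_d1 -> 'rV[R]_d2 -> 'rV[R]_d2)
  (xs : 'rV[R]_d2 -> 'rV[R]_d1) (phi : 'rV[R]_d2 -> R)
  (dphi : 'rV[R]_d2 -> 'rV[R]_d2) (yb : 'rV[R]_d2) (L rho Lp G : R)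
  (X_convex : convex_set X) (L_gt0 : 0 < L) (rho_gt0 : 0 < rho) (Lp_gt0 : 0 < Lp)
  (G_gt0 : 0 < G)
  (xs_in : forall y, X (xs y))
  (xs_monotone : forall x y, X x ->
     dotr (gx x y) (x - xs y) <= - rho * enorm (x - xs y) ^+ 2)
  (xs_lip : forall y y', enorm (xs y - xs y') <= L / rho * enorm (y - y'))
  (gx_growth : forall x y, X x -> enorm (gx x y) ^+ 2 <= G * (1 + enorm (y - yb) ^+ 2))
  (gy_growth : forall x y, X x -> enorm (gy x y) ^+ 2 <= G * (1 + enorm (y - yb) ^+ 2))
  (gy_lip : forall x y, X x -> enorm (dphi y - gy x y) <= L * enorm (x - xs y))
  (phi_lower : forall y y', phi y + dotr (dphi y) (y' - y) <= phi y')
  (phi_upper : forall y y',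
     phi y' <= phi y + dotr (dphi y) (y' - y) + Lp * enorm (y' - y) ^+ 2)
  (phi_min : forall y, phi yb <= phi y)
  (A : R) (A_gt0 : 0 < A).
Context (x : 'rV[R]_d1) (y : 'rV[R]_d2) (m : 'rV[R]_d1) (m' : 'rV[R]_d2) (a b : R)
  (Xx : X x) (a_gt0 : 0 < a) (aA : a <= A) (b_gt0 : 0 < b).

Let Y := enorm (y - yb) ^+ 2.
Let Z := enorm (x - xs y) ^+ 2.
Let N := enorm m ^+ 2 + enorm m' ^+ 2.
(** The common scale of all second-order terms: squared gradients grow like [1 + Y] and the noise
    adds [N]. *)
Let T := 1 + Y + N.
Let q := b ^+ 2 / a.
Let y' := y + b *: (- gy x y + m').
Let G' := 2 * G + 2.

Let Y0 : 0 <= Y. Proof. exact: sqr_ge0. Qed.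
Let Z0 : 0 <= Z. Proof. exact: sqr_ge0. Qed.
Let N0 : 0 <= N. Proof. by rewrite addr_ge0 ?sqr_ge0. Qed.
Let T0 : 0 <= T. Proof. by rewrite /T; move: Y0 N0; lra. Qed.
Let q0 : 0 < q. Proof. by rewrite divr_gt0 ?exprn_gt0. Qed.
Let G'0 : 0 < G'. Proof. by have := G_gt0; rewrite /G'; lra. Qed.

Let gxT : enorm (gx x y + m) ^+ 2 <= G' * T.
Proof.
have h1 := enorm_sqrD2 (gx x y) m; have h2 := gx_growth y Xx; rewrite -/Y in h2.
have h3 : 0 <= G * N by nonneg.
have : 0 <= enorm m' ^+ 2 := sqr_ge0 _.
move: Y0; rewrite /G' /T /N; rewrite /N in h3; lra.
Qed.

Let gyT : enorm (- gy x y + m') ^+ 2 <= G' * T.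
Proof.
have h1 := enorm_sqrD2 (- gy x y) m'; have h2 := gy_growth y Xx; rewrite -/Y in h2.
have h3 : 0 <= G * N by nonneg.
have : 0 <= enorm m ^+ 2 := sqr_ge0 _.
rewrite enormN in h1.
move: Y0; rewrite /G' /T /N; rewrite /N in h3; lra.
Qed.

Let bE : b ^+ 2 = a * q.
Proof. by rewrite /q mulrCA divff ?gt_eqF// mulr1. Qed.

Let bT : b ^+ 2 * enorm (- gy x y + m') ^+ 2 <= A * q * (G' * T).
Proof.
apply: ler_pM => //; rewrite ?sqr_ge0//.
by rewrite bE ler_pM2r.
Qed.

Let gyZ : enorm (dphi y - gy x y) ^+ 2 <= L ^+ 2 * Z.
Proof.
rewrite /Z -exprMn ler_pXn2r ?nnegrE ?enorm_ge0 ?gy_lip//.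
by rewrite mulr_ge0 ?enorm_ge0// ltW.
Qed.

Let yE : y' - y = b *: (- gy x y + m').
Proof. by rewrite /y' addrC addKr. Qed.

(** Convexity gives [<dphi y, y - yb> >= 0]. What remains of the drift is the error of using [x] in
    place of [xs y]. *)
Lemma one_step_Y :
  enorm (y' - yb) ^+ 2 <= Y + rho * a * Z + dotr ((2 * b) *: (y - yb)) m'
    + (L ^+ 2 / rho + A * G') * q * T.
Proof.
have -> : y' - yb = (y - yb) + b *: (- gy x y + m') by rewrite /y' addrAC.
rewrite enorm_sqrD enorm_sqrZ dotrZr dotrDr dotrNr -/Y dotrZl.
have h1 := phi_lower y yb; have h2 := phi_min y.
rewrite -(opprB y yb) dotrNr in h1.
(* With this Young weight the error costs exactly [rho a Z], the amount that [one_step_Z] gains. *)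
have c0 : 0 < rho * a / L ^+ 2 by rewrite divr_gt0 ?mulr_gt0 ?exprn_gt0.
have h3 := dotr_young (dphi y - gy x y) (b *: (y - yb)) c0.
rewrite enorm_sqrZ dotrZr dotrBl -/Y in h3.
rewrite [dotr (y - yb) (gy x y)]dotrC.
have h4 : rho * a / L ^+ 2 * enorm (dphi y - gy x y) ^+ 2 <= rho * a * Z.
  rewrite -mulrA ler_wpM2l //; first by rewrite mulr_ge0// ltW.
  by rewrite ler_pdivrMl ?exprn_gt0.
have h5 : (rho * a / L ^+ 2)^-1 * (b ^+ 2 * Y) = L ^+ 2 / rho * q * Y.
  by rewrite /q; field; rewrite !gt_eqF.
have h6 : b * dotr (dphi y) (y - yb) >= 0 by rewrite mulr_ge0 ?(ltW b_gt0)//; lra.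
have h8 : L ^+ 2 / rho * q * Y <= L ^+ 2 / rho * q * T.
  by apply: ler_wpM2l; [nonneg|rewrite /T; have := N0; lra].
move: bT h3; rewrite h5; set u := L ^+ 2 / rho in h5 h8 *; lra.
Qed.

(** The projected step contracts towards the old target [xs y] by [1 - 2 rho a]; Young with weight
    [rho a] then accounts for the motion of the target. Half of the contraction survives, and the
    motion, of order [b^2], is divided by [a]. *)
Lemma one_step_Z x' : projection X (x + a *: (gx x y + m)) x' ->
  enorm (x' - xs y') ^+ 2 <= (1 - rho * a) * Z
    + dotr ((2 * a * (1 + rho * a)) *: (x - xs y)) m
    + ((1 + rho * A) * G' + (A + rho^-1) * (L / rho) ^+ 2 * G') * (a ^+ 2 + q) * T.
Proof.
move=> x'P.
have ra0 : 0 < rho * a by rewrite mulr_gt0.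
have h1 := projection_to X_convex x'P (xs_in y).
have h2 := enorm_sqrD_young (x' - xs y) (xs y - xs y') ra0.
rewrite addrA subrK in h2.
rewrite [_ + _ - xs y]addrAC (enorm_sqrD (x - xs y)) enorm_sqrZ dotrZr dotrDr -/Z in h1.
have h3 := xs_monotone y Xx; rewrite -/Z dotrC in h3.
have h4 : enorm (xs y - xs y') ^+ 2 <= (L / rho) ^+ 2 * (b ^+ 2 * (G' * T)).
  have k1 : enorm (xs y - xs y') ^+ 2 <= (L / rho * enorm (y - y')) ^+ 2.
    by rewrite ler_pXn2r ?nnegrE ?enorm_ge0// mulr_ge0 ?enorm_ge0// divr_ge0// ltW.
  apply: le_trans k1 _; rewrite exprMn ler_wpM2l ?sqr_ge0//.
  by rewrite enormB yE enorm_sqrZ ler_wpM2l ?sqr_ge0.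
rewrite bE in h4.
have h5 : (1 + (rho * a)^-1) * enorm (xs y - xs y') ^+ 2
    <= (A + rho^-1) * (L / rho) ^+ 2 * G' * q * T.
  have k1 : (1 + (rho * a)^-1) * a <= A + rho^-1.
    by rewrite mulrDl mul1r invfM -mulrA mulVf ?gt_eqF// mulr1 lerD2r.
  have k2 : 0 <= 1 + (rho * a)^-1 by rewrite addr_ge0// invr_ge0 ltW.
  have k4 := ler_wpM2l k2 h4.
  have k3 : 0 <= (L / rho) ^+ 2 * G' * q * T by nonneg.
  have := ler_wpM2r k3 k1; move: k4; set w := (L / rho) ^+ 2; set v := 1 + (rho * a)^-1; lra.
have h6 : (1 + rho * a) * enorm (x' - xs y) ^+ 2 <=
    (1 + rho * a) * (Z + 2 * a * (- rho * Z) + 2 * a * dotr (x - xs y) m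
     + a ^+ 2 * (G' * T)).
  apply: ler_wpM2l; first by rewrite addr_ge0// ltW.
  apply: le_trans h1 _.
  have k1 := ler_wpM2l (sqr_ge0 a) gxT.
  have k2 := ler_wpM2l (ltW a_gt0) h3.
  lra.
have h7 : (1 + rho * a) * (a ^+ 2 * (G' * T)) <= (1 + rho * A) * G' * a ^+ 2 * T.
  have k3 : 0 <= a ^+ 2 * (G' * T) by nonneg.
  have k4 : 1 + rho * a <= 1 + rho * A by rewrite lerD2l ler_pM2l.
  have := ler_wpM2r k3 k4; lra.
have h8 : 0 <= rho * a * (rho * a) * Z by nonneg.
have h9 : 0 <= (1 + rho * A) * G' * q * T by nonneg.
have h10 : 0 <= (A + rho^-1) * (L / rho) ^+ 2 * G' * a ^+ 2 * T by nonneg.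
rewrite dotrZl; set w := (L / rho) ^+ 2 in h5 h10 *; set r := rho^-1 in h5 h10 *.
lra.
Qed.

(** Descent along an inexact gradient: half of [b |dphi|^2] pays for the cross term with the
    gradient error, leaving [L^2 b Z / 2]. *)
Lemma one_step_phi :
  phi y' - phi yb <= (phi y - phi yb) - b / 2 * enorm (dphi y) ^+ 2
    + L ^+ 2 / 2 * b * Z + dotr (b *: dphi y) m' + Lp * G' * b ^+ 2 * T.
Proof.
have h1 := phi_upper y y'.
rewrite yE enorm_sqrZ dotrZr dotrDr dotrNr in h1.
have h2 : 0 <= Lp * b ^+ 2 by nonneg.
have h3 := ler_wpM2l h2 gyT.
have h4 := dotr_young (dphi y) (dphi y - gy x y) ltr01.
rewrite invr1 !mul1r dotrBr -enorm_sqr in h4.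
have h5 : b * (enorm (dphi y) ^+ 2 / 2 - dotr (dphi y) (gy x y)) <= b * (L ^+ 2 / 2 * Z).
  by rewrite ler_pM2l//; move: gyZ; lra.
rewrite dotrZl; lra.
Qed.

End OneStep.

(** * Step sizes and scalar recursions *)

Section PowerIncrements.
Context {R : realType}.
Implicit Types u s e : R.

Lemma powR_pD u s t : 0 < u -> u `^ (s + t) = u `^ s * u `^ t.
Proof. by move=> u0; rewrite powRD// (gt_eqF u0) implybT. Qed.

(** Bernoulli's inequality for non-positive exponents, from [u^s = exp (s ln u)], [exp x >= 1 + x]
    and [ln u <= u - 1]. *)
Lemma powR_ge_tangent (u s : R) : 0 < u -> s <= 0 -> 1 + s * (u - 1) <= u `^ s.
Proof.
move=> u0 s0; rewrite /powR gt_eqF//; apply: le_trans (expR_ge1Dx _).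
rewrite lerD2l ler_wnM2l//.
by have := @le_ln1Dx R (u - 1); rewrite addrCA subrr addr0; apply; lra.
Qed.

Lemma powRN_succ_ge u s : 1 <= u -> 0 <= s ->
  u `^ (- s) * (1 - s / u) <= (u + 1) `^ (- s).
Proof.
move=> u1 s0; have u0 : 0 < u by apply: lt_le_trans u1.
have -> : u + 1 = u * (1 + u^-1) by rewrite mulrDr mulr1 divff// gt_eqF.
have v0 : 0 < 1 + u^-1 by rewrite addr_gt0// invr_gt0.
rewrite powRM ?(ltW u0) ?(ltW v0)// ler_wpM2l ?powR_ge0//.
apply: le_trans (powR_ge_tangent v0 _); last by rewrite oppr_le0.
by rewrite [1 + u^-1 - 1]addrAC subrr add0r mulNr.
Qed.

(** Turns the summable power into the decrement of an explicit sequence, in place of an integral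
    comparison. *)
Lemma powRN_telescope u e : 1 <= u -> 0 < e <= 1 ->
  u `^ (- (1 + e)) <= 4 / e * (u `^ (- e) - (u + 1) `^ (- e)).
Proof.
move=> u1 /andP[e0 e1]; have u0 : 0 < u by apply: lt_le_trans u1.
have v0 : 0 < u + 1 by rewrite addr_gt0.
set v := u + 1 in v0 *.
have h1 : e * v `^ (- (1 + e)) <= u `^ (- e) - v `^ (- e).
  have -> : u = v * (u / v) by rewrite mulrCA divff ?mulr1// gt_eqF.
  have w0 : 0 < u / v by rewrite divr_gt0.
  rewrite powRM ?(ltW v0) ?(ltW w0)//.
  have := powR_ge_tangent w0 (s := - e); rewrite oppr_le0 (ltW e0) => /(_ isT) h.
  have := ler_wpM2l (powR_ge0 v (- e)) h.
  have -> : u / v - 1 = - v^-1 by rewrite /v; field; rewrite gt_eqF.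
  rewrite opprD powR_pD// powR_inv1 ?(ltW v0)//; set r := v^-1; lra.
(* Since [u + 1 <= 2 u], shifting the base costs at most [2^(1 + e) <= 4]. *)
have h2 : u `^ (- (1 + e)) <= 4 * v `^ (- (1 + e)).
  have v2u : v <= 2 * u by rewrite /v; lra.
  rewrite !powRN ler_pdivlMr ?powR_gt0// mulrC ler_pdivrMr ?powR_gt0//.
  have k1 : v `^ (1 + e) <= (2 * u) `^ (1 + e).
    by rewrite ge0_ler_powR ?nnegrE ?addr_ge0 ?mulr_ge0// ltW.
  apply: le_trans k1 _; rewrite powRM ?(ltW u0)// ler_wpM2r ?powR_ge0//.
  apply: (@le_trans _ _ (2 `^ 2)); last by rewrite powR_mulrn//; lra.
  by rewrite ler_powR//; lra.
rewrite -mulrA; apply: le_trans h2 _.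
by rewrite ler_pM2l// ler_pdivlMl.
Qed.

End PowerIncrements.

Section Recursions.
Context {R : realType}.

(** Discrete Gronwall: by [1 + x <= exp x] the product [(1 + v k) * expR (C * t k)] never
    increases. *)
Lemma gronwall_telescoping (v t : nat -> R) (C : R) : 0 <= C ->
  (forall k, 0 <= v k) -> (forall k, 0 <= t k) ->
  (forall k, v k.+1 <= v k + C * (t k - t k.+1) * (1 + v k)) ->
  forall k, v k <= (1 + v 0%N) * expR (C * t 0%N).
Proof.
move=> C0 v0 t0 h.
have key k : (1 + v k) * expR (C * t k) <= (1 + v 0%N) * expR (C * t 0%N).
  elim: k => [//|k IH]; apply: le_trans IH.
  have -> : C * t k = C * (t k - t k.+1) + C * t k.+1 by ring.
  rewrite expRD mulrA ler_wpM2r ?expR_ge0//.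
  have := ler_wpM2l (addr_ge0 ler01 (v0 k)) (expR_ge1Dx (C * (t k - t k.+1))).
  by have := h k; lra.
move=> k; apply: le_trans (key k).
apply: (@le_trans _ _ (1 + v k)); first by rewrite lerDr.
by rewrite ler_peMr ?addr_ge0// (le_trans _ (expR_ge1Dx _))// lerDl mulr_ge0.
Qed.

(** If [z] stayed above [d] from [m] on, the contraction would remove a multiple of the divergent
    harmonic series, while the telescoping forcing adds a bounded amount. *)
Lemma vanishing_subsequence (z a t : nat -> R) (c C rho : R) :
  0 < c -> 0 < rho -> 0 <= C ->
  (forall k, 0 <= z k) -> (forall k, 0 <= t k) ->
  (forall k, c / k.+1%:R <= a k) ->
  (forall k, z k.+1 <= z k - rho * a k * z k + C * (t k - t k.+1)) ->
  forall d, 0 < d -> forall m, exists2 k, (m <= k)%N & z k < d.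
Proof.
move=> c0 rho0 C0 z0 t0 ac hz d d0 m; apply: contrapT => hn.
have zd k : (m <= k)%N -> d <= z k.
  by move=> mk; rewrite leNgt; apply/negP => zk; apply: hn; exists k.
have tel n : rho * c * d * \sum_(m <= k < m + n) (k.+1%:R)^-1
    <= z m + C * t m - C * t (m + n)%N - z (m + n)%N.
  elim: n => [|n IH]; first by rewrite addn0 big_geq// mulr0; lra.
  rewrite addnS big_nat_recr ?leq_addr//= mulrDr.
  have h1 := hz (m + n)%N; have h2 := zd (m + n)%N (leq_addr _ _).
  have h3 : rho * c * d * ((m + n).+1%:R)^-1 <= rho * a (m + n)%N * z (m + n)%N.
    have cx0 : 0 <= c / (m + n).+1%:R by rewrite divr_ge0// ltW.
    have := ler_wpM2l (ltW rho0) (ler_pM cx0 (ltW d0) (ac (m + n)%N) h2).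
    set x := (_.+1%:R)^-1; lra.
  set x := (_.+1%:R)^-1 in h3 *. lra.
have bnd n : \sum_(m <= k < m + n) (k.+1%:R : R)^-1 <= (z m + C * t m) / (rho * c * d).
  rewrite ler_pdivlMr ?mulr_gt0// mulrC; apply: le_trans (tel n) _.
  have : 0 <= C * t (m + n)%N by rewrite mulr_ge0.
  by have := z0 (m + n)%N; lra.
apply: (@dvg_harmonic R); apply: nondecreasing_is_cvgn.
  by apply: nondecreasing_series => k _ _; rewrite /harmonic/= invr_ge0.
exists (\sum_(0 <= k < m) (k.+1%:R : R)^-1 + (z m + C * t m) / (rho * c * d)).
move=> _ [n _ <-]; rewrite /series/=.
have [nm|mn] := leqP n m.
  rewrite [in leRHS](big_cat_nat (leq0n n) nm)/= -addrA lerDl addr_ge0//.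
    by rewrite sumr_ge0// => k _; rewrite invr_ge0.
  by rewrite divr_ge0 ?addr_ge0 ?mulr_ge0// ltW.
rewrite (big_cat_nat (leq0n m) (ltnW mn))/= lerD2l.
by rewrite -{1}(subnKC (ltnW mn)); exact: bnd.
Qed.

(* The constant A is so large that the bound is propagated in both cases: if s k is
   below half of it, trivially; otherwise because the quadratic term dominates. *)
Lemma quadratic_recursion_rate (s : nat -> R) (K c C e : R) :
  1 <= K -> 0 < c -> 0 <= C -> 0 < e < 1 / 4 -> (forall k, 0 <= s k) ->
  (forall k, s k.+1 <= s k - c * (k%:R + K) `^ (- (3 / 4 + e)) * s k ^+ 2
     + C * (k%:R + K) `^ (- (5 / 4))) ->
  exists2 A, 0 <= A & forall k, s k <= A * (k%:R + K) `^ (- (1 / 4 - e)).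
Proof.
move=> K1 c0 C0 /andP[e0 e1] s0 hs.
(* The summands serve, in order, the start of the induction, [4 C <= A] for the forcing, and
   [2 <= c A] for the quadratic term. *)
pose A := s 0%N * K `^ (1 / 4 - e) + 4 * C + 2 / c.
have A0 : 0 < A.
  by have k0 := s0 0%N; rewrite /A ltr_wpDl ?divr_gt0//; nonneg.
exists A => [|k]; first exact: ltW.
elim: k => [|k IH].
  rewrite add0r powRN ler_pdivlMr ?powR_gt0 ?(lt_le_trans _ K1)//.
  by rewrite /A -addrA lerDl; nonneg.
have u1 : 1 <= k%:R + K by rewrite -[leLHS]add0r lerD.
set u := k%:R + K in u1 IH *.
have u0 : 0 < u by apply: lt_le_trans u1.
have -> : k.+1%:R + K = u + 1 by rewrite /u -natr1 addrAC.
have h1 := hs k; rewrite -/u in h1.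
have sl : 0 <= 1 / 4 - e by lra.
have h2 := ler_wpM2l (ltW A0) (powRN_succ_ge u1 sl).
apply: le_trans h2.
set w := u `^ (- (1 / 4 - e)) in IH *; have w0 : 0 < w by rewrite powR_gt0.
have ui : u^-1 <= 1 by rewrite invf_le1.
have ui0 : 0 < u^-1 by rewrite invr_gt0.
have h54 : u `^ (- (5 / 4)) <= w * u^-1.
  rewrite -[u^-1]powR_inv1 ?(ltW u0)// -powR_pD// ler_powR//; lra.
have CA : 4 * C <= A.
  by have k0 := s0 0%N; rewrite /A -addrA addrCA lerDl; nonneg.
have cA : 2 <= c * A.
  rewrite /A mulrDr mulrCA divff ?gt_eqF// mulr1 lerDr.
  by have k0 := s0 0%N; nonneg.
have Cw : C * u `^ (- (5 / 4)) <= A / 4 * w * u^-1.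
  rewrite -mulrA; apply: ler_pM; rewrite ?powR_ge0//; lra.
have wu : A * w * u^-1 <= A * w by rewrite ler_piMr//; nonneg.
have [small|large] := leP (s k) (A * w / 2).
  have k1 : 0 <= c * u `^ (- (3 / 4 + e)) * s k ^+ 2.
    by rewrite !mulr_ge0 ?powR_ge0 ?sqr_ge0// ltW.
  have k2 : (1 / 4 - e) * (A * w * u^-1) <= 1 / 4 * (A * w).
    by apply: ler_pM => //; [nonneg|lra].
  lra.
have k1 : (A * w / 2) ^+ 2 <= s k ^+ 2.
  by rewrite ler_pXn2r ?nnegrE// ?(ltW large)//; nonneg.
(* The balance that determines the rate: with [w] of exponent [1/4 - e] the quadratic gain has the
   order [w / u] of one step of decay of [w]. *)
have k2 : u `^ (- (3 / 4 + e)) * w ^+ 2 = w * u^-1.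
  rewrite expr2 mulrCA; congr (_ * _).
  rewrite -[u^-1]powR_inv1 ?(ltW u0)// -powR_pD//; congr (_ `^ _); lra.
have k3 : c * u `^ (- (3 / 4 + e)) * (A * w / 2) ^+ 2 <=
          c * u `^ (- (3 / 4 + e)) * s k ^+ 2.
  by rewrite ler_wpM2l// mulr_ge0 ?powR_ge0// ltW.
have k4 : c * u `^ (- (3 / 4 + e)) * (A * w / 2) ^+ 2 = (c * A) * A / 4 * (w * u^-1).
  by rewrite -k2; field.
have k5 : 2 * (A / 4 * (w * u^-1)) <= (c * A) * (A / 4 * (w * u^-1)).
  by rewrite ler_wpM2r//; nonneg.
have k6 : 0 <= e * (A * w * u^-1) by nonneg.
lra.
Qed.

End Recursions.

(** * Orders of magnitude of the step sizes *)

Section StepSizes.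
Context {R : realType} (alpha beta e K : R).
Context (alpha_gt0 : 0 < alpha) (beta_gt0 : 0 < beta) (e_bounds : 0 < e < 1 / 4)
  (K_ge1 : 1 <= K).

Let u (k : nat) : R := k%:R + K.
Let a k := alpha / u k `^ (1 / 2 + 66 / 100 * e).
Let b k := beta / u k `^ (3 / 4 + e).

Let e0 : 0 < e. Proof. by case/andP: e_bounds. Qed.
Let e1 : e < 1 / 4. Proof. by case/andP: e_bounds. Qed.

Lemma shift_ge1 k : 1 <= u k.
Proof. by rewrite -[leLHS]add0r lerD. Qed.

Let u0 k : 0 < u k. Proof. exact: lt_le_trans (shift_ge1 k). Qed.

Let aN k : a k = alpha * u k `^ (- (1 / 2 + 66 / 100 * e)).
Proof. by rewrite powRN. Qed.

Let bN k : b k = beta * u k `^ (- (3 / 4 + e)).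
Proof. by rewrite powRN. Qed.

Lemma step_a_gt0 k : 0 < a k. Proof. by rewrite divr_gt0// powR_gt0. Qed.

Lemma step_b_gt0 k : 0 < b k. Proof. by rewrite divr_gt0// powR_gt0. Qed.

Lemma powRN_le1 k s : 0 <= s -> u k `^ (- s) <= 1.
Proof. by move=> s0; rewrite -[leRHS](powRr0 (u k)) ler_powR ?shift_ge1// oppr_le0. Qed.

Lemma step_a_le k : a k <= alpha.
Proof.
rewrite aN ler_piMr ?(ltW alpha_gt0)//; apply: powRN_le1.
by have := e0; lra.
Qed.

(** The exponent of the fast step is below 1 because [e < 1/4]; this is the divergence of its sum,
    in the form of a harmonic minorant. *)
Lemma step_a_ge k : alpha / K / k.+1%:R <= a k.
Proof.
have K0 : 0 < K by apply: lt_le_trans K_ge1.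
rewrite -mulrA -invfM ler_pM2l// lef_pV2 ?posrE ?powR_gt0 ?mulr_gt0//.
apply: (@le_trans _ _ (u k)).
  rewrite -[leRHS]powRr1 ?(ltW (u0 k))// ler_powR ?shift_ge1//.
  by have := e1; lra.
rewrite /u -natr1 mulrDr mulr1 lerD2r -[leLHS]mul1r ler_wpM2r//.
Qed.

Let ratioE k : b k / a k = beta / alpha * u k `^ (- (1 / 4 + 34 / 100 * e)).
Proof.
rewrite aN bN invfM -powRN mulrACA -powR_pD//; congr (_ * _ `^ _); lra.
Qed.

Lemma step_ratio_le k : b k / a k <= beta / alpha.
Proof.
by rewrite ratioE ler_piMr ?(ltW (divr_gt0 _ _))//; apply: powRN_le1; have := e0; lra.
Qed.

Lemma step_ratio_decreasing k : b k.+1 / a k.+1 <= b k / a k.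
Proof.
rewrite !ratioE ler_wpM2l ?(ltW (divr_gt0 _ _))// !powRN lef_pV2 ?posrE ?powR_gt0//.
rewrite ge0_ler_powR ?nnegrE ?(ltW (u0 _))//; first by have := e0; lra.
by rewrite /u lerD2r ler_nat.
Qed.

Let pw_le k s t : s <= t -> u k `^ (- t) <= u k `^ (- s).
Proof. by move=> st; rewrite ler_powR ?shift_ge1// lerN2. Qed.

Let a2E k : a k ^+ 2 = alpha ^+ 2 * u k `^ (- (1 + 132 / 100 * e)).
Proof.
rewrite aN exprMn expr2 [X in _ * X]expr2 -powR_pD//; congr (_ * _ `^ _); lra.
Qed.

Let qE k : b k ^+ 2 / a k = beta ^+ 2 / alpha * u k `^ (- (1 + 134 / 100 * e)).
Proof.
rewrite expr2 -mulrA ratioE bN mulrACA -powR_pD//; congr (_ * _ `^ _); last by lra.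
by rewrite expr2 mulrA.
Qed.

(** The exponents of the two terms are [1 + 1.32 e] and [1 + 1.34 e], both above [1 + e]. *)
Lemma step_forcing k : a k ^+ 2 + b k ^+ 2 / a k <=
  (alpha ^+ 2 + beta ^+ 2 / alpha) * u k `^ (- (1 + e)).
Proof.
have h := e0.
rewrite a2E qE [leRHS]mulrDl; apply: lerD; apply: ler_wpM2l; try exact: sqr_ge0.
- by apply: pw_le; lra.
- by rewrite divr_ge0 ?sqr_ge0// ltW.
- by apply: pw_le; lra.
Qed.

Lemma step_b2 k : b k ^+ 2 <= beta ^+ 2 * u k `^ (- (5 / 4)).
Proof.
rewrite bN exprMn ler_wpM2l ?sqr_ge0// expr2 -powR_pD// -opprD.
by apply: pw_le; have := e0; lra.
Qed.

(** The ratio contributes [1/4 + 0.34 e] and the forcing at least [1 + 1.32 e], which together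
    exceed [5/4]. *)
Lemma step_slow_forcing k : b k / a k * (a k ^+ 2 + b k ^+ 2 / a k) <=
  (beta / alpha * (alpha ^+ 2 + beta ^+ 2 / alpha)) * u k `^ (- (5 / 4)).
Proof.
have h := e0; have r0 : 0 <= beta / alpha by rewrite divr_ge0// ltW.
have c0 : 0 <= alpha ^+ 2 + beta ^+ 2 / alpha.
  by rewrite addr_ge0 ?divr_ge0 ?sqr_ge0// ltW.
have h2 : a k ^+ 2 + b k ^+ 2 / a k <=
    (alpha ^+ 2 + beta ^+ 2 / alpha) * u k `^ (- (1 + 132 / 100 * e)).
  rewrite a2E qE [leRHS]mulrDl; apply: lerD => //; apply: ler_wpM2l.
    by rewrite divr_ge0 ?sqr_ge0// ltW.
  by apply: pw_le; lra.
rewrite ratioE; apply: le_trans (ler_wpM2l _ h2) _.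
  by rewrite mulr_ge0 ?powR_ge0.
rewrite mulrACA -powR_pD// -opprD; apply: ler_wpM2l; first exact: mulr_ge0.
by apply: pw_le; lra.
Qed.

Lemma powRN_5_4_le k : u k `^ (- (5 / 4)) <= u k `^ (- (1 + e)).
Proof. by apply: pw_le; have := e1; lra. Qed.

Lemma powRN_vanishes d : 0 < d -> exists m, forall k, (m <= k)%N -> u k `^ (- e) < d.
Proof.
move=> d0; have v0 : 0 < d^-1 `^ e^-1 by rewrite powR_gt0// invr_gt0.
exists (Num.truncn (d^-1 `^ e^-1)).+1 => k mk.
have uv : d^-1 `^ e^-1 < u k.
  apply: lt_le_trans (truncnS_gt _) _.
  by rewrite /u ler_wpDr ?(le_trans ler01)// ler_nat.
rewrite powRN invf_plt ?posrE ?powR_gt0//.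
have -> : d^-1 = (d^-1 `^ e^-1) `^ e.
  by rewrite -powRrM mulVf ?gt_eqF// powRr1// invr_ge0 ltW.
by rewrite gt0_ltr_powR ?nnegrE ?(ltW v0) ?(ltW (u0 k)).
Qed.

End StepSizes.

(** * Measurability and centered noise *)

Section Measurability.
Context {R : realType}.

(** Random vectors are measurable coordinatewise, so the preimage of an open set is written as a
    countable union of preimages of rational boxes, each described by coordinates. *)
Lemma measurable_continuous_row d (T : measurableType d) (n : nat)
    (f : 'rV[R]_n -> R) (Z : T -> 'rV[R]_n) :
  continuous f -> (forall j, measurable_fun [set: T] (fun w => Z w 0 j)) ->
  measurable_fun [set: T] (f \o Z).
Proof.
move=> cf mZ.
apply: (measurability _ (RGenOInfty.measurableE R)) => _ [_ [r ->] <-].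
rewrite setTI.
pose box (p : 'rV[rat]_n * nat) : set 'rV[R]_n :=
  [set z | forall j, `|z 0 j - ratr (p.1 0 j)| < p.2.+1%:R^-1].
(* Boxes that are not contained in the open set are replaced by [set0], so the index type stays
   countable. *)
pose F (p : 'rV[rat]_n * nat) : set T :=
  if `[< box p `<=` f @^-1` `]r, +oo[ >] then Z @^-1` box p else set0.
have mF p : measurable (F p).
  rewrite /F; case: ifPn => // _.
  rewrite (_ : _ @^-1` _ = ~` \bigcup_j
      ~` [set w | `|Z w 0 j - ratr (p.1 0 j)| < p.2.+1%:R^-1]); last first.
    rewrite setC_bigcup; under eq_bigcapr do rewrite setCK.
    by apply/seteqP; split => [w h j _|w h j]; [exact: h|exact: (h j I)].
  apply: measurableC; apply: (countable_bigcupT_measurable (countableP _)) => j.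
  apply: measurableC; rewrite -[X in measurable X]setTI.
  rewrite (_ : [set w | _] = (fun w => `|Z w 0 j - ratr (p.1 0 j)|) @^-1`
      `]-oo, (p.2.+1%:R^-1)[); last first.
    by apply/seteqP; split => w /=; rewrite in_itv.
  have : measurable_fun [set: T] (fun w => `|Z w 0 j - ratr (p.1 0 j)|).
    by apply: measurableT_comp => //; exact: measurable_funB.
  exact.
rewrite (_ : _ @^-1` _ = \bigcup_p F p).
  exact: (countable_bigcupT_measurable (countableP _) mF).
apply/seteqP; split => [w /= fr|w [p _]].
  have /cf /nbhs_ballP[e /= e0 he] : nbhs (f (Z w)) `]r, +oo[%classic.
    by apply: open_nbhs_nbhs; split => //; exact: interval_open.
  (* Half of [e], because the box is centered at a rational point that is itself only close to
     [Z w]. *)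
  have [m me] : exists m : nat, m.+1%:R^-1 < e / 2.
    have [|m] := @ltr_add_invr R 0 (e / 2); first by rewrite divr_gt0.
    by rewrite add0r; exists m.
  have /choice[q hq] (j : 'I_n) : exists q : rat, `|Z w 0 j - ratr q| < m.+1%:R^-1.
    have mp : 0 < m.+1%:R^-1 :> R by rewrite invr_gt0.
    have [|q] := @rat_in_itvoo R (Z w 0 j - m.+1%:R^-1) (Z w 0 j + m.+1%:R^-1).
      by move: mp; set i := _.+1%:R^-1; lra.
    rewrite in_itv /= => /andP[q1 q2]; exists q.
    rewrite ltr_norml; move: q1 q2; set i := m.+1%:R^-1 => q1 q2.
    by apply/andP; split; lra.
  exists (\row_j q j, m) => //; rewrite /F asboolT => [j /=|z hz]; first by rewrite mxE.
  apply: he; split => // i j; rewrite (ord1 i) /ball/=.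
  have := hz j; rewrite /= mxE => h1; have h2 := hq j.
  rewrite -(subrK (ratr (q j)) (Z w 0 j)) -addrA (le_lt_trans (ler_normD _ _))//.
  rewrite -normrN opprB in h1.
  by move: h1 h2 me; set c := m.+1%:R^-1; lra.
by rewrite /F; case: ifPn => // /asboolP h Zp; apply: h.
Qed.

End Measurability.

Section ConditionallyCentered.
Import HBSimple HBNNSimple.
Context {R : realType} {disp : measure_display} {T : measurableType disp}
  (P : probability T R) (G : set_system T) (GT : <<s G>> `<=` measurable).
Local Notation gT := (g_sigma_algebraType G).

Lemma sub_measurable_fun (f : T -> R) :
  measurable_fun [set: gT] (f : gT -> R) -> measurable_fun [set: T] f.
Proof. by move=> mf _ B mB; apply: GT; exact: (mf measurableT _ mB). Qed.

Context (m : T -> R) (mi : P.-integrable [set: T] (EFin \o m))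
  (m0 : forall A, <<s G>> A -> (\int[P]_(w in A) (m w)%:E = 0)%E).

(* The level sets of a simple function measurable for G are events of G. *)
Lemma integral_nnsfun_centered (h : {nnsfun gT >-> R}) A : <<s G>> A ->
  P.-integrable A (EFin \o (fun w => h w * m w)) /\
  (\int[P]_(w in A) (h w * m w)%:E = 0)%E.
Proof.
move=> GA; have mA : measurable A by exact: GT.
have mT : P.-integrable A (EFin \o m) by exact: integrableS mi.
have [N [c hE]] : exists N (c : 'I_N -> R),
    forall w, h w = \sum_(i < N) (c i * \1_(h @^-1` [set c i]) w).
  by eexists; eexists; exact: fimfunEord.
pose B i : set T := h @^-1` [set c i].
have GB i : <<s G>> (B i) by exact: (measurable_funPTI h (measurable_set1 (c i))).
pose F i w := ((c i)%:E * ((EFin \o m) \_ (B i)) w)%E.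
have hmE w : (h w * m w)%:E = (\sum_(i < N) F i w)%E.
  rewrite hE mulr_suml -sumEFin; apply: eq_bigr => i _.
  rewrite /F patchE indicE /B; case: (w \in _) => /=.
    by rewrite mulr1 EFinM.
  by rewrite mulr0 mul0r mule0.
have Bint i : P.-integrable A ((EFin \o m) \_ (B i)).
  apply/integrable_restrict => //; first exact: GT.
  by apply: (integrableS mA) mT => //; apply: measurableI => //; exact: GT.
have Fint i : P.-integrable A (F i) by exact: integrableZl.
split.
  apply: eq_integrable
    (integrable_sum mA (index_enum 'I_N) (P := xpredT) (fun i _ => Fint i)) => //.
  by move=> w _ /=; rewrite hmE.
under eq_integral do rewrite hmE.
rewrite integral_sum//; apply: big1 => i _.
rewrite integralZl// -integral_mkcondr m0 ?mule0//.
exact: (@measurableI _ gT _ _ GA (GB i)).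
Qed.

(** Simple functions adapted to [G] increase to [g], and [|g m|] dominates their products with
    [m]. *)
Lemma integral_ge0_centered (g : T -> R) A : <<s G>> A -> (forall w, 0 <= g w) ->
  measurable_fun [set: gT] (g : gT -> R) ->
  P.-integrable [set: T] (EFin \o (fun w => g w * m w)) ->
  (\int[P]_(w in A) (g w * m w)%:E = 0)%E.
Proof.
move=> GA g0 mg gmi; have mA : measurable A by exact: GT.
have mf : measurable_fun [set: gT] (EFin \o g : gT -> \bar R) by exact/measurable_EFinP.
pose h n := nnsfun_approx measurableT mf n.
have hg n w : 0 <= h n w <= g w.
  rewrite fun_ge0 /h nnsfun_approxE -lee_fin.
  by apply: le_approx => // w' _; rewrite lee_fin.
have hcv w : EFin \o h ^~ w @ \oo --> (g w)%:E.
  by apply: (@cvg_nnsfun_approx _ gT) => // w' _; rewrite lee_fin.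
have gmA : P.-integrable A (EFin \o (fun w => g w * m w)) by exact: integrableS gmi.
have mm : measurable_fun A m.
  by apply/measurable_EFinP; apply: measurable_funTS; exact: measurable_int mi.
have [|||||_ _] := @dominated_convergence _ T R P A mA
    (fun n w => (h n w * m w)%:E) (fun w => (g w * m w)%:E) (fun w => `|(g w * m w)%:E|%E).
- by move=> n; have [hi _] := integral_nnsfun_centered (h n) GA; exact: measurable_int hi.
- exact: measurable_int gmA.
- apply: aeW => w _; rewrite EFinM; under eq_fun do rewrite EFinM.
  by apply: cvgeZr => //; exact: hcv.
- exact: integrable_abse.
- apply: aeW => w n _; rewrite lee_fin !normrM ler_wpM2r//.
  by have /andP[h1 h2] := hg n w; rewrite !ger0_norm.
under eq_fun do rewrite (integral_nnsfun_centered _ GA).2.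
by move=> /cvg_lim <-//; rewrite lim_cst.
Qed.

(** Writes [g] as [(g + |g|) - |g|], a difference of two non-negative adapted factors whose products
    with [m] are integrable. *)
Lemma integral_centered (g : T -> R) A : <<s G>> A ->
  measurable_fun [set: gT] (g : gT -> R) ->
  P.-integrable [set: T] (EFin \o (fun w => g w * m w)) ->
  (\int[P]_(w in A) (g w * m w)%:E = 0)%E.
Proof.
move=> GA mg gmi; have mA : measurable A by exact: GT.
have mabs : measurable_fun [set: gT] (fun w : gT => `|g w|) by exact: measurableT_comp.
have mm : measurable_fun [set: T] m by apply/measurable_EFinP; exact: measurable_int mi.
have absi : P.-integrable [set: T] (EFin \o (fun w => `|g w| * m w)).
  apply: le_integrable gmi => //.
    apply/measurable_EFinP; apply: measurable_funM => //; exact: sub_measurable_fun.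
  by move=> w _; rewrite /= lee_fin !normrM normr_id.
have sumi : P.-integrable [set: T] (EFin \o (fun w => (g w + `|g w|) * m w)).
  apply: eq_integrable (integrableD measurableT gmi absi) => // w _.
  by rewrite /= -EFinD mulrDl.
have h1 := integral_ge0_centered GA (fun w => normr_ge0 (g w)) mabs absi.
have h2 : (\int[P]_(w in A) ((g w + `|g w|) * m w)%:E = 0)%E.
  apply: integral_ge0_centered => // [w|].
    by rewrite -lerBlDr sub0r lerNnormlW.
  exact: measurable_funD.
have -> : (\int[P]_(w in A) (g w * m w)%:E =
    \int[P]_(w in A) ((g w + `|g w|) * m w)%:E - \int[P]_(w in A) (`|g w| * m w)%:E)%E.
  rewrite -integralB//; [|exact: integrableS sumi|exact: integrableS absi].
  by apply: eq_integral => w _; rewrite -EFinB mulrDl addrK.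
by rewrite h1 h2 sube0.
Qed.

End ConditionallyCentered.

(** * From pathwise to integrated inequalities *)

Section ConditionalStep.
Context {R : realType} {disp : measure_display} {T : measurableType disp}
  (P : probability T R).

Lemma integrable_measurable (f : T -> R) :
  P.-integrable [set: T] (EFin \o f) -> measurable_fun [set: T] f.
Proof. by move=> fi; apply/measurable_EFinP; exact: measurable_int fi. Qed.

Lemma integrable_dominated (f g : T -> R) : measurable_fun [set: T] f ->
  P.-integrable [set: T] (EFin \o g) -> (forall w, `|f w| <= g w) ->
  P.-integrable [set: T] (EFin \o f).
Proof.
move=> mf gi fg; apply: (le_integrable measurableT _ _ gi).
  exact/measurable_EFinP.
by move=> w _; rewrite /= lee_fin (le_trans (fg w))// ler_norm.
Qed.

Lemma integrable_addr (f g : T -> R) :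
  P.-integrable [set: T] (EFin \o f) -> P.-integrable [set: T] (EFin \o g) ->
  P.-integrable [set: T] (EFin \o (fun w => f w + g w)).
Proof. by move=> fi gi; apply: eq_integrable (integrableD measurableT fi gi). Qed.

Lemma integrable_scale (c : R) (f : T -> R) :
  P.-integrable [set: T] (EFin \o f) ->
  P.-integrable [set: T] (EFin \o (fun w => c * f w)).
Proof. by move=> fi; apply: eq_integrable (integrableZl measurableT c fi). Qed.

Lemma integrable_cst (c : R) : P.-integrable [set: T] (EFin \o (fun=> c)).
Proof. exact: finite_measure_integrable_cst. Qed.

Lemma integrable_dotr (d : nat) (u v : T -> 'rV[R]_d) (B : T -> R) :
  random_vector u -> random_vector v -> P.-integrable [set: T] (EFin \o B) ->
  (forall w, enorm (u w) ^+ 2 + enorm (v w) ^+ 2 <= B w) ->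
  (forall j, P.-integrable [set: T] (EFin \o (fun w => u w 0 j * v w 0 j))).
Proof.
move=> mu mv Bi uvB j; apply: integrable_dominated Bi _.
  exact: measurable_funM.
move=> w; apply: le_trans (uvB w); rewrite normrM.
have h1 := ler_coord_enorm (u w) j; have h2 := ler_coord_enorm (v w) j.
set p := enorm (u w) in h1 *; set q := enorm (v w) in h2 *.
have := normr_ge0 (u w 0 j); have := normr_ge0 (v w 0 j).
set r := `|u w 0 j| in h1 *; set s := `|v w 0 j| in h2 *.
move=> s0 r0; have := sqr_ge0 (p - q); nra.
Qed.

(** The bound on [V] holds only almost everywhere; [min V Vb] equals [V] almost everywhere and is
    below [Vb] everywhere. *)
Lemma cond_exp_le (F : set_system T) (N V Vb : T -> R) (A : set T) :
  is_cond_exp P F N V -> {ae P, forall w, V w <= Vb w} ->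
  P.-integrable [set: T] (EFin \o Vb) -> F A -> measurable A ->
  \int[P]_(w in A) N w <= \int[P]_(w in A) Vb w.
Proof.
move=> [Ni Vi _ NV] VVb Vbi FA mA.
have -> : \int[P]_(w in A) N w = \int[P]_(w in A) Num.min (V w) (Vb w).
  congr fine; rewrite -NV//; apply: ae_eq_integral => //.
  - exact: measurable_funTS (measurable_int _ Vi).
  - apply/measurable_EFinP; apply: measurable_funTS; apply: measurable_minr;
      exact: integrable_measurable.
  - by move: VVb; apply: filterS => w h _; rewrite min_l.
have mi : P.-integrable [set: T] (EFin \o (fun w => Num.min (V w) (Vb w))).
  apply: (@integrable_dominated _ (fun w => `|V w| + `|Vb w|)).
  - by apply: measurable_minr; exact: integrable_measurable.
  - by apply: integrable_addr; apply: integrable_norm.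
  - by move=> w; rewrite minEle; case: ifP => _; rewrite ?lerDl ?lerDr.
apply: le_Rintegral => //; try exact: (integrableS measurableT).
by move=> w _; rewrite ge_min lexx orbT.
Qed.

Context (G : set_system T) (GT : <<s G>> `<=` measurable).
Local Notation gT := (g_sigma_algebraType G).

(** The common passage for all three Lyapunov functions. The linear noise term has an adapted
    coefficient [g], so it integrates to 0 over an event of the past; the bound by [K * B] makes it
    integrable. *)
Lemma expected_step (d : nat) (m g : T -> 'rV[R]_d) (N B U S : T -> R) (K c c1 : R)
    (A : set T) :
  (forall j, is_cond_exp P <<s G>> (fun w => m w 0 j) (cst 0)) ->
  (forall j, measurable_fun [set: gT] (fun w : gT => g w 0 j)) ->
  (forall w, enorm (m w) ^+ 2 <= N w) -> (forall w, enorm (g w) ^+ 2 <= K * B w) ->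
  P.-integrable [set: T] (EFin \o N) -> P.-integrable [set: T] (EFin \o B) ->
  P.-integrable [set: T] (EFin \o U) -> P.-integrable [set: T] (EFin \o S) ->
  0 <= c1 -> <<s G>> A ->
  \int[P]_(w in A) N w <= c * \int[P]_(w in A) B w ->
  (forall w, U w <= S w + dotr (g w) (m w) + c1 * (B w + N w)) ->
  \int[P]_(w in A) U w <= \int[P]_(w in A) S w + c1 * (1 + c) * \int[P]_(w in A) B w.
Proof.
move=> m0 mg mN gB Ni Bi Ui Si c10 GA NB step.
have mA : measurable A by exact: GT.
have inA f : P.-integrable [set: T] (EFin \o f) -> P.-integrable A (EFin \o f).
  by move=> fi; exact: (integrableS measurableT).
have gmi : forall j, P.-integrable [set: T] (EFin \o (fun w => g w 0 j * m w 0 j)).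
  apply: (@integrable_dotr _ _ _ (fun w => K * B w + N w)).
  - by move=> j; exact: sub_measurable_fun (mg j).
  - by move=> j; have [h _ _ _] := m0 j; exact: integrable_measurable.
  - by apply: integrable_addr => //; exact: integrable_scale.
  - by move=> w; exact: lerD.
have dE : (fun w => (dotr (g w) (m w))%:E) = (fun w => \sum_(j < d) (g w 0 j * m w 0 j)%:E)%E.
  by apply/funext => w; rewrite sumEFin.
have di : P.-integrable [set: T] (EFin \o (fun w => dotr (g w) (m w))).
  by rewrite /comp dE; apply: integrable_sum => //= j _; exact: gmi.
have d0 : \int[P]_(w in A) dotr (g w) (m w) = 0.
  rewrite /Rintegral dE integral_sum//; last by move=> j; exact: inA.
  rewrite big1// => j _; apply: (integral_centered GT _ _ GA (mg j) (gmi j)).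
    by have [] := m0 j.
  move=> B' GB'; have [_ _ _ /(_ B' GB') <-] := m0 j.
  by rewrite integral0_eq.
have sdi := integrable_addr Si di.
have bni := integrable_scale c1 (integrable_addr Bi Ni).
have := le_Rintegral mA (inA _ Ui) (inA _ (integrable_addr sdi bni)) (fun w _ => step w).
rewrite RintegralD//; try exact: inA.
rewrite RintegralD//; try exact: inA.
rewrite d0 addr0 RintegralZl//; last by apply: inA; exact: integrable_addr.
rewrite RintegralD//; try exact: inA.
move=> /le_trans; apply; rewrite lerD2l -mulrA ler_wpM2l//.
by rewrite mulrDl mul1r lerD2l.
Qed.

End ConditionalStep.

(** * Maximal inequality *)

Section MaximalInequality.
Context {R : realType} {disp : measure_display} {T : measurableType disp}
  (P : probability T R) (G : nat -> set_system T)
  (GT : forall k, <<s G k>> `<=` measurable)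
  (GS : forall k, <<s G k>> `<=` <<s G k.+1>>).

(** Markov's inequality that retains the integral below the level, the quantity carried along in the
    maximal inequality. *)
Lemma markov_split (D : set T) (f : T -> R) l : 0 <= l -> measurable D ->
  measurable_fun [set: T] f -> P.-integrable [set: T] (EFin \o f) ->
  l * fine (P (D `&` [set w | l <= f w])) + \int[P]_(w in D `&` [set w | f w < l]) f w
    <= \int[P]_(w in D) f w.
Proof.
move=> l0 mD mf fi.
have m1 : measurable [set w | l <= f w].
  rewrite (_ : [set _ | _] = f @^-1` `[l, +oo[%classic); last first.
    by apply/seteqP; split => w; rewrite /= in_itv/= andbT.
  by rewrite -[X in measurable X]setTI; exact: mf.
have m2 : measurable [set w | f w < l].
  rewrite (_ : [set _ | _] = f @^-1` `]-oo, l[%classic); last first.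
    by apply/seteqP; split => w; rewrite /= in_itv.
  by rewrite -[X in measurable X]setTI; exact: mf.
have mD1 := measurableI _ _ mD m1; have mD2 := measurableI _ _ mD m2.
have DE : D = (D `&` [set w | l <= f w]) `|` (D `&` [set w | f w < l]).
  rewrite -setIUr -[LHS]setIT; congr (_ `&` _); apply/seteqP; split => // w _ /=.
  by case: (leP l (f w)); [left|right].
rewrite [in leRHS]DE Rintegral_setU//.
- rewrite lerD2r -(Rintegral_cst P mD1); apply: le_Rintegral => //.
  + by apply: finite_measure_integrable_cst.
  + exact: integrableS fi.
  + by move=> w [_].
- apply: integrableS fi => //; exact: measurableU.
- apply/disj_setPS => w [[_ /= h1] [_ /= h2]].
  by move: h2; rewrite ltNge h1.
Qed.

Context (V : nat -> T -> R) (s : nat -> R)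
  (V_ge0 : forall k w, 0 <= V k w)
  (V_adapted : forall k, measurable_fun [set: g_sigma_algebraType (G k)]
     (V k : g_sigma_algebraType (G k) -> R))
  (V_int : forall k, P.-integrable [set: T] (EFin \o V k))
  (s_ge0 : forall k, 0 <= s k)
  (V_step : forall k A, <<s G k>> A ->
    \int[P]_(w in A) V k.+1 w <= \int[P]_(w in A) V k w + (s k - s k.+1)).

Definition hits l n m : set T := [set w | exists k, (n <= k <= n + m)%N /\ l <= V k w].

Let mV k : measurable_fun [set: T] (V k).
Proof. by move=> _ B mB; apply: (@GT k); exact: (@V_adapted k measurableT _ mB). Qed.

Let ge_event l k : <<s G k>> [set w | l <= V k w].
Proof.
rewrite (_ : [set _ | _] = V k @^-1` `[l, +oo[%classic); last first.
  by apply/seteqP; split => w; rewrite /= in_itv/= andbT.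
by rewrite -[X in <<s _>> X]setTI; apply: (@V_adapted k) => //; exact: measurableT.
Qed.

Lemma hitsS l n m : hits l n m.+1 = hits l n m `|` [set w | l <= V (n + m).+1 w].
Proof.
apply/seteqP; split => w.
  move=> [k [/andP[nk]]]; rewrite addnS leq_eqVlt => /orP[/eqP ->|km] lV; first by right.
  by left; exists k; rewrite nk -ltnS km.
move=> [[k [/andP[nk km] lV]]|lV].
  by exists k; rewrite nk addnS ltnW.
by exists (n + m).+1; rewrite addnS leqnn andbT ltnW// ltnS leq_addr.
Qed.

Lemma hits_measurable l n m : <<s G (n + m)%N>> (hits l n m).
Proof.
elim: m => [|m IH].
  rewrite (_ : hits _ _ _ = [set w | l <= V n w]); first by rewrite addn0; exact: ge_event.
  apply/seteqP; split => w; last by exists n; rewrite addn0 leqnn.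
  by move=> [k []]; rewrite addn0 -eqn_leq => /eqP <-.
rewrite hitsS addnS.
apply: (@measurableU _ (g_sigma_algebraType (G (n + m).+1))).
  exact: (GS IH).
exact: ge_event.
Qed.

Let mhits l n m : measurable (hits l n m).
Proof. by apply: (@GT (n + m)%N); exact: hits_measurable. Qed.

(* Induction on m: by [markov_split], the mass of V on the event that l has not been
   reached pays for the probability of reaching it at the next step. *)
Lemma maximal_ineq_finite l n m : 0 <= l ->
  l * fine (P (hits l n m)) <= \int[P]_w V n w + s n.
Proof.
move=> l0.
suff : l * fine (P (hits l n m)) + \int[P]_(w in ~` hits l n m) V (n + m)%N w
    <= \int[P]_w V n w + (s n - s (n + m)%N).
  have : 0 <= \int[P]_(w in ~` hits l n m) V (n + m)%N w by apply: Rintegral_ge0.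
  by have := s_ge0 (n + m)%N; lra.
elim: m => [|m IH].
  rewrite addn0 subrr addr0.
  have := markov_split l0 measurableT (mV n) (V_int n).
  rewrite !setTI (_ : hits _ _ _ = [set w | l <= V n w]); last first.
    apply/seteqP; split => w; last by exists n; rewrite addn0 leqnn.
    by move=> [k []]; rewrite addn0 -eqn_leq => /eqP <-.
  rewrite (_ : ~` _ = [set w | V n w < l])//.
  by apply/seteqP; split => w /=; rewrite ltNge => /negP.
have mC := measurableC (mhits l n m).
have hC : <<s G (n + m)%N>> (~` hits l n m).
  by apply: (@measurableC _ (g_sigma_algebraType (G (n + m)%N))); exact: hits_measurable.
have h1 := V_step hC.
have h2 := markov_split l0 mC (mV (n + m).+1) (V_int (n + m).+1).
have e1 : ~` hits l n m.+1 = ~` hits l n m `&` [set w | V (n + m).+1 w < l].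
  rewrite hitsS setCU; congr (_ `&` _).
  by apply/seteqP; split => w /=; rewrite ltNge => /negP.
have e2 : fine (P (hits l n m.+1)) = fine (P (hits l n m)) +
    fine (P (~` hits l n m `&` [set w | l <= V (n + m).+1 w])).
  have mE : measurable [set w | l <= V (n + m).+1 w] by apply: (@GT (n + m).+1); exact: ge_event.
  have -> : hits l n m.+1 = hits l n m `|` (~` hits l n m `&` [set w | l <= V (n + m).+1 w]).
    by rewrite hitsS setUIr setUv setTI.
  have m3 := measurableI _ _ mC mE.
  rewrite measureU//; first by rewrite fineD// fin_num_measure.
  by rewrite setIA setICr set0I.
rewrite e1 e2 addnS mulrDr; lra.
Qed.

Definition hits_after l n : set T := [set w | exists k, (n <= k)%N /\ l <= V k w].

Lemma hits_after_bigcup l n : hits_after l n = \bigcup_m hits l n m.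
Proof.
apply/seteqP; split => w.
  by move=> [k [nk lV]]; exists (k - n)%N => //; exists k; rewrite nk subnKC ?leqnn.
by move=> [m _ [k [/andP[nk _] lV]]]; exists k.
Qed.

Lemma hits_after_measurable l n : measurable (hits_after l n).
Proof. by rewrite hits_after_bigcup; apply: bigcup_measurable => m _; exact: mhits. Qed.

Lemma maximal_ineq l n : 0 < l ->
  (P (hits_after l n) <= ((\int[P]_w V n w + s n) / l)%:E)%E.
Proof.
move=> l0; rewrite hits_after_bigcup.
have cv : P (hits l n m) @[m --> \oo] --> P (\bigcup_m hits l n m).
  apply: nondecreasing_cvg_mu.
  - by move=> m; exact: mhits.
  - by apply: bigcup_measurable => m _; exact: mhits.
  - by apply/nondecreasing_seqP => m; apply/subsetPset; rewrite hitsS; exact: subsetUl.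
rewrite -(cvg_lim _ cv)//; apply: lime_le; first by apply/cvg_ex; eexists; exact: cv.
apply: nearW => m.
rewrite -[P _]fineK ?fin_num_measure// lee_fin ler_pdivlMr// mulrC.
exact: (maximal_ineq_finite n m (ltW l0)).
Qed.

Lemma ae_bounded : {ae P, forall w, exists K, forall k, V k w <= K}.
Proof.
pose B := \bigcap_(j : nat) hits_after j.+1%:R 0%N.
have mB : measurable B by apply: bigcap_measurable => // j _; exact: hits_after_measurable.
exists B; split => //; last first.
  move=> w /= h j _; apply: contrapT => hj; apply: h; exists j.+1%:R => k.
  by rewrite leNgt; apply/negP => jV; apply: hj; exists k; split => //; exact: ltW.
apply/eqP; rewrite eq_le measure_ge0 andbT; apply/lee_addgt0Pr => e e0; rewrite add0e.
pose K := \int[P]_w V 0%N w + s 0%N.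
have K0 : 0 <= K by rewrite addr_ge0//; apply: Rintegral_ge0.
have [|j] := @ltr_add_invr R 0 (e / (K + 1)); first by rewrite divr_gt0// ltr_wpDl.
rewrite add0r => je.
apply: (@le_trans _ _ (P (hits_after j.+1%:R 0%N))).
  by apply: le_measure; rewrite ?inE//; [exact: hits_after_measurable|exact: bigcap_inf].
apply: le_trans (maximal_ineq _ _) _ => //; rewrite -/K lee_fin.
move: je; rewrite ltr_pdivlMr ?ltr_wpDl//; set i := _.+1%:R^-1 => je.
have i0 : 0 < i by rewrite invr_gt0.
nra.
Qed.

(** The maximal inequality restarted at one index [n] with small mean controls all later values, so
    smallness of the mean along a subsequence is enough. *)
Lemma ae_cvg0 : (forall e, 0 < e -> exists n, \int[P]_w V n w + s n < e) ->
  {ae P, forall w, V k w @[k --> \oo] --> (0 : R)}.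
Proof.
move=> small.
pose N j := \bigcap_(n : nat) hits_after j.+1%:R^-1 n.
have mN j : measurable (N j).
  by apply: bigcap_measurable => // n _; exact: hits_after_measurable.
have N0 j : P (N j) = 0%E.
  apply/eqP; rewrite eq_le measure_ge0 andbT; apply/lee_addgt0Pr => e e0; rewrite add0e.
  have j0 : 0 < j.+1%:R^-1 :> R by rewrite invr_gt0.
  have [n hn] := small (e * j.+1%:R^-1) (mulr_gt0 e0 j0).
  apply: (@le_trans _ _ (P (hits_after j.+1%:R^-1 n))).
    by apply: le_measure; rewrite ?inE//; [exact: hits_after_measurable|exact: bigcap_inf].
  apply: le_trans (maximal_ineq _ j0) _; rewrite lee_fin ler_pdivrMr//; exact: ltW.
have mU : measurable (\bigcup_j N j) by apply: bigcup_measurable.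
exists (\bigcup_j N j); split => //.
  apply/negligibleP => //; apply: negligible_bigcup => j.
  by apply/negligibleP; [exact: mN|exact: N0].
move=> w /= h; apply: contrapT => hN; apply: h.
apply/cvgrPdist_lt => e e0.
have [j] := @ltr_add_invr R 0 e e0; rewrite add0r => je.
have : ~ N j w by move=> Nj; apply: hN; exists j.
move=> /existsNP[n /not_implyP[_ hn]].
exists n => // k /= nk; rewrite sub0r normrN ger0_norm//; apply: lt_trans je.
by rewrite ltNge; apply/negP => jV; apply: hn; exists k.
Qed.

End MaximalInequality.

(** * Almost supermartingales *)

Lemma Rintegral_prob_cst {R : realType} d (T : measurableType d) (P : probability T R) (c : R) :
  \int[P]_w c = c.
Proof.
rewrite (Rintegral_cst P measurableT) -[RHS]mulr1; congr (_ * _).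
exact: (congr1 (@fine _) (probability_setT P)).
Qed.

Section LyapunovSystem.
Context {R : realType} {disp : measure_display} {T : measurableType disp}
  (P : probability T R) (Gn : nat -> set_system T)
  (GT : forall k, <<s Gn k>> `<=` measurable)
  (GS : forall k, <<s Gn k>> `<=` <<s Gn k.+1>>).
Local Notation FT k := (g_sigma_algebraType (Gn k)).
Context (Y Z W U : nat -> T -> R)
  (Y0 : forall k w, 0 <= Y k w) (Z0 : forall k w, 0 <= Z k w)
  (W0 : forall k w, 0 <= W k w) (U0 : forall k w, 0 <= U k w)
  (Y_adapted : forall k, measurable_fun [set: FT k] (Y k : FT k -> R))
  (Z_adapted : forall k, measurable_fun [set: FT k] (Z k : FT k -> R))
  (W_adapted : forall k, measurable_fun [set: FT k] (W k : FT k -> R))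
  (Y_int : forall k, P.-integrable [set: T] (EFin \o Y k))
  (Z_int : forall k, P.-integrable [set: T] (EFin \o Z k))
  (W_int : forall k, P.-integrable [set: T] (EFin \o W k))
  (U_int : forall k, P.-integrable [set: T] (EFin \o U k))
  (eps alpha beta K1 rho C0 cL D2 : R)
  (eps_bounds : 0 < eps < 1 / 4)
  (alpha_gt0 : 0 < alpha) (beta_gt0 : 0 < beta) (K1_ge1 : 1 <= K1)
  (rho_gt0 : 0 < rho) (C00 : 0 <= C0) (cL0 : 0 <= cL)
  (a b : nat -> R)
  (aE : forall k, a k = alpha / (k%:R + K1) `^ (1 / 2 + 66 / 100 * eps))
  (bE : forall k, b k = beta / (k%:R + K1) `^ (3 / 4 + eps)).
Let gam k := a k ^+ 2 + b k ^+ 2 / a k.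
Let meanY k := \int[P]_w Y k w.
Let meanZ k := \int[P]_w Z k w.
Let meanW k := \int[P]_w W k w.
Let meanU k := \int[P]_w U k w.
Context (Z_le : forall k w, Z k w <= D2)
  (W_young : forall k w t, 2 * t * W k w <= t ^+ 2 * U k w + Y k w)
  (stepY : forall k A, <<s Gn k>> A ->
  \int[P]_(w in A) Y k.+1 w <= \int[P]_(w in A) Y k w
    + rho * a k * \int[P]_(w in A) Z k w + C0 * gam k * (1 + meanY k))
  (stepZ : forall k A, <<s Gn k>> A ->
  \int[P]_(w in A) Z k.+1 w <= (1 - rho * a k) * \int[P]_(w in A) Z k w
    + C0 * gam k * (1 + meanY k))
  (stepW : forall k A, <<s Gn k>> A ->
  \int[P]_(w in A) W k.+1 w <= \int[P]_(w in A) W k w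
    + cL * b k * \int[P]_(w in A) Z k w - b k / 2 * \int[P]_(w in A) U k w
    + C0 * b k ^+ 2 * (1 + meanY k)).

Let mY0 k : 0 <= meanY k. Proof. by apply: Rintegral_ge0. Qed.
Let mZ0 k : 0 <= meanZ k. Proof. by apply: Rintegral_ge0. Qed.
Let mW0 k : 0 <= meanW k. Proof. by apply: Rintegral_ge0. Qed.
Let mU0 k : 0 <= meanU k. Proof. by apply: Rintegral_ge0. Qed.

Let a_gt0 k : 0 < a k. Proof. by rewrite aE; exact: step_a_gt0. Qed.
Let b_gt0 k : 0 < b k. Proof. by rewrite bE; exact: step_b_gt0. Qed.

Let u k := k%:R + K1.
(** A stand-in for the tail of the series of [u k] to the power [-(1 + eps)]: by [tau_step] its
    decrement dominates the general term. *)
Let tau k := 4 / eps * u k `^ (- eps).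
Let cg := alpha ^+ 2 + beta ^+ 2 / alpha.

Let eps0 : 0 < eps. Proof. by case/andP: eps_bounds. Qed.

Let tau0 k : 0 <= tau k.
Proof. by rewrite mulr_ge0 ?powR_ge0// divr_ge0// ltW. Qed.

Let cg0 : 0 < cg.
Proof. by rewrite addr_gt0 ?divr_gt0 ?exprn_gt0. Qed.

Let u1 k : 1 <= u k. Proof. exact: shift_ge1. Qed.

Let tau_step k : u k `^ (- (1 + eps)) <= tau k - tau k.+1.
Proof.
rewrite /tau -mulrBr (_ : u k.+1 = u k + 1); last by rewrite /u -natr1 addrAC.
apply: powRN_telescope => //; rewrite eps0 /=.
by case/andP: eps_bounds => _ h; lra.
Qed.

Let gam_le k : gam k <= cg * (tau k - tau k.+1).
Proof.
apply: (@le_trans _ _ (cg * u k `^ (- (1 + eps)))); last by rewrite ler_pM2l.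
by rewrite /gam aE bE; exact: step_forcing.
Qed.

Let gam0 k : 0 <= gam k.
Proof. by rewrite addr_ge0 ?divr_ge0 ?sqr_ge0// ltW. Qed.

Let GTfull k : <<s Gn k>> [set: T].
Proof. exact: (@measurableT _ (FT k)). Qed.

Lemma mean_stepY k :
  meanY k.+1 <= meanY k + rho * a k * meanZ k + C0 * gam k * (1 + meanY k).
Proof. exact: stepY. Qed.

Lemma mean_stepZ k :
  meanZ k.+1 <= (1 - rho * a k) * meanZ k + C0 * gam k * (1 + meanY k).
Proof. exact: stepZ. Qed.

(** In the sum the terms [rho a Z] cancel; two forcing terms remain, hence the factor 2 in the
    exponential. *)
Lemma meanYZ_bounded : exists Bd, forall k, meanY k + meanZ k <= Bd.
Proof.
exists ((1 + (meanY 0%N + meanZ 0%N)) * expR (2 * C0 * cg * tau 0%N)) => k.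
apply: (gronwall_telescoping (v := fun k => meanY k + meanZ k)) => //.
- by apply: mulr_ge0 (ltW cg0); apply: mulr_ge0 => //; exact: C00.
- by move=> j; rewrite addr_ge0.
move=> j /=.
have h1 := mean_stepY j; have h2 := mean_stepZ j.
have h3 : C0 * gam j * (1 + meanY j) <=
    C0 * (cg * (tau j - tau j.+1)) * (1 + (meanY j + meanZ j)).
  apply: ler_pM.
  - by apply: mulr_ge0; [exact: C00|exact: gam0].
  - by rewrite addr_ge0.
  - by apply: ler_wpM2l; [exact: C00|exact: gam_le].
  by rewrite addrA lerDl.
by move: h1 h2 h3; lra.
Qed.


Let inA k A f : <<s Gn k>> A -> P.-integrable [set: T] (EFin \o f) -> P.-integrable A (EFin \o f).
Proof. by move=> /GT mA fi; exact: (integrableS measurableT). Qed.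

Let psi k := b k / a k.
Let psi0 k : 0 < psi k. Proof. by rewrite divr_gt0. Qed.

Let psi_le k : psi k <= beta / alpha.
Proof. by rewrite /psi aE bE; exact: step_ratio_le. Qed.

Let psi_decreasing k : psi k.+1 <= psi k.
Proof. by rewrite /psi !aE !bE; exact: step_ratio_decreasing. Qed.

(** Bounded means freeze the factor [1 + meanY k], so every forcing becomes a deterministic multiple
    of a telescoping decrement or of the power [-5/4]. *)
Lemma uniform_forcing : exists2 K, 0 < K & forall k,
  [/\ meanY k <= K,
      C0 * gam k * (1 + meanY k) <= K * (tau k - tau k.+1),
      C0 * b k ^+ 2 * (1 + meanY k) <= K * u k `^ (- (5 / 4)) &
      psi k * (C0 * gam k * (1 + meanY k)) <= K * u k `^ (- (5 / 4))].
Proof.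
have [Bd hB] := meanYZ_bounded.
have Bd0 : 0 <= Bd by apply: le_trans (hB 0%N); rewrite addr_ge0.
have hY k : meanY k <= Bd by apply: le_trans (hB k); rewrite lerDl.
have C0' := C00; have cg' := ltW cg0; have r0 : 0 <= beta / alpha by apply: ltW; exact: divr_gt0.
pose K := C0 * (1 + Bd) * (cg + beta ^+ 2 + beta / alpha * cg) + Bd + 1.
have K1p : 0 <= C0 * (1 + Bd) by apply: mulr_ge0 => //; lra.
have p1 : 0 <= C0 * (1 + Bd) * cg by exact: mulr_ge0.
have p2 : 0 <= C0 * (1 + Bd) * beta ^+ 2 by apply: mulr_ge0 => //; exact: sqr_ge0.
have p3 : 0 <= C0 * (1 + Bd) * (beta / alpha * cg) by apply: mulr_ge0 => //; exact: mulr_ge0.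
exists K => [|k]; first by rewrite /K; lra.
have BY : C0 * (1 + meanY k) <= C0 * (1 + Bd) by rewrite ler_wpM2l// lerD2l.
have BY0 : 0 <= C0 * (1 + meanY k) by apply: mulr_ge0 => //; rewrite addr_ge0.
have bound t z v : 0 <= t -> 0 <= v -> 0 <= z -> t <= z * v -> C0 * (1 + Bd) * z <= K ->
    C0 * t * (1 + meanY k) <= K * v.
  move=> t0 v0 z0 tz zK; rewrite mulrAC.
  apply: (@le_trans _ _ (C0 * (1 + Bd) * (z * v))); first exact: ler_pM.
  by rewrite mulrA ler_wpM2r.
split.
- by apply: le_trans (hY k) _; rewrite /K; lra.
- apply: (bound _ cg) => //.
  + exact: le_trans (powR_ge0 _ _) (tau_step k).
  + by rewrite /K; lra.
- apply: (bound _ (beta ^+ 2)); rewrite ?powR_ge0 ?sqr_ge0//.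
  + by rewrite bE; exact: step_b2.
  + by rewrite /K; lra.
- have -> : psi k * (C0 * gam k * (1 + meanY k)) = C0 * (psi k * gam k) * (1 + meanY k).
    by ring.
  apply: (bound _ (beta / alpha * cg)); rewrite ?powR_ge0//.
  + by apply: mulr_ge0; [exact: ltW|exact: gam0].
  + exact: mulr_ge0.
  + by rewrite /psi /gam aE bE; exact: step_slow_forcing.
  + by rewrite /K; lra.
Qed.

(** The maximal inequality is applied to [Y + Z], where the perturbation of Y is cancelled by the
    contraction of Z. *)
Lemma lyapunov_ae_bounded : {ae P, forall w, exists K, forall k, Y k w <= K}.
Proof.
have [K K0 hK] := uniform_forcing.
pose s k := 2 * K * tau k.
have s0 k : 0 <= s k by apply: mulr_ge0 (tau0 k); lra.
have : {ae P, forall w, exists K, forall k, Y k w + Z k w <= K}.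
  apply: (@ae_bounded R disp T P Gn GT GS _ s) => //.
  - by move=> k w; rewrite addr_ge0.
  - by move=> k; exact: measurable_funD.
  - by move=> k; exact: integrable_addr.
  - move=> k A GA; have mA := GT GA.
    rewrite !RintegralD//; try exact: (inA GA).
    have [_ hf _ _] := hK k.
    by have := stepY GA; have := stepZ GA; rewrite /s; lra.
move=> hae; apply: filterS hae => w [Kw hKw]; exists Kw => k.
by apply: le_trans (hKw k); rewrite lerDl.
Qed.

Let vanishing_tau e : 0 < e -> exists m, forall k, (m <= k)%N -> tau k < e.
Proof.
move=> e0; have d0 : 0 < e / (4 / eps) by rewrite !divr_gt0.
have [m hm] := powRN_vanishes eps_bounds K1_ge1 d0.
exists m => k /hm; rewrite ltr_pdivlMr ?divr_gt0// => h.
by rewrite /tau mulrC.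
Qed.

(** Dropping its contraction, Z alone fits the maximal inequality; the contraction is used for the
    means, to find indices where they are small. *)
Lemma lyapunov_Z_ae_cvg0 : {ae P, forall w, Z k w @[k --> \oo] --> (0 : R)}.
Proof.
have [K K0 hK] := uniform_forcing.
pose s k := K * tau k.
have s0 k : 0 <= s k by apply: mulr_ge0 (tau0 k); exact: ltW.
apply: (@ae_cvg0 R disp T P Gn GT GS Z s) => // [k A GA|e e0].
  have [_ hf _ _] := hK k.
  have h : 0 <= rho * a k * \int[P]_(w in A) Z k w.
    by apply: mulr_ge0; [apply: mulr_ge0; exact: ltW|exact: Rintegral_ge0].
  by have := stepZ GA; rewrite /s; lra.
have e20 : 0 < e / 2 / K by rewrite !divr_gt0.
have [m hm] := vanishing_tau e20.
have K1p : 0 < K1 by apply: lt_le_trans K1_ge1.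
have step k : meanZ k.+1 <= meanZ k - rho * a k * meanZ k + K * (tau k - tau k.+1).
  by have [_ hf _ _] := hK k; have := mean_stepZ k; lra.
(* The index is taken beyond [m], where the forcing tail is already below [e / 2]; the mean of Z
   takes the other half. *)
have [|||k mk hk] := @vanishing_subsequence R meanZ a tau (alpha / K1) K rho _ rho_gt0
    (ltW K0) mZ0 tau0 _ step (e / 2) _ m.
- exact: divr_gt0.
- by move=> k; rewrite aE; exact: step_a_ge.
- exact: divr_gt0.
exists k; have := hm _ mk; rewrite ltr_pdivlMr// mulrC -/(meanZ k) /s; lra.
Qed.

(** Chosen so that [kap * psi k * (rho * a k) = (cL + 1) * b k]: the part [cL] pays for the
    perturbation of W, and the 1 leaves a gain of [b k] times Z. *)
Let kap := (cL + 1) / rho.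
Let kap0 : 0 < kap. Proof. by rewrite divr_gt0// ltr_wpDl. Qed.

Let S k w := W k w + kap * psi k * Z k w.
Let meanS k := \int[P]_w S k w.

Let S0 k w : 0 <= S k w.
Proof. by rewrite addr_ge0// mulr_ge0// mulr_ge0// ltW. Qed.

Let SE k A : <<s Gn k>> A -> \int[P]_(w in A) S k w =
  \int[P]_(w in A) W k w + kap * psi k * \int[P]_(w in A) Z k w.
Proof.
move=> GA; have mA := GT GA; rewrite RintegralD//; try exact: (inA GA).
  by rewrite RintegralZl//; exact: (inA GA).
by apply: (inA GA); exact: integrable_scale.
Qed.

(** Because the ratio [psi] decreases, the new weight of Z may be replaced by the old one before the
    contraction is applied. *)
Let stepS : exists2 K, 0 < K & forall k A, <<s Gn k>> A ->
  \int[P]_(w in A) S k.+1 w <= \int[P]_(w in A) S k w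
    - b k * (\int[P]_(w in A) U k w / 2 + \int[P]_(w in A) Z k w) + K * u k `^ (- (5 / 4)).
Proof.
have [K K0 hK] := uniform_forcing.
exists ((1 + kap) * K) => [|k A GA]; first by rewrite mulr_gt0// addr_gt0.
have [_ _ hf1 hf2] := hK k.
have GA' : <<s Gn k.+1>> A by exact: GS.
rewrite !SE//.
have z0 : 0 <= \int[P]_(w in A) Z k.+1 w by exact: Rintegral_ge0.
have h1 : kap * psi k.+1 * \int[P]_(w in A) Z k.+1 w <= kap * psi k * \int[P]_(w in A) Z k.+1 w.
  by apply: ler_wpM2r => //; apply: ler_wpM2l; [exact: ltW|exact: psi_decreasing].
have kp : 0 <= kap * psi k by apply: mulr_ge0; exact: ltW.
have h2 := ler_wpM2l kp (stepZ GA).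
have h3 : kap * psi k * (rho * a k) = (cL + 1) * b k.
  by rewrite /kap /psi; field; rewrite !gt_eqF.
have h4 := ler_wpM2l (ltW kap0) hf2.
have h5 := stepW GA.
move: h1 h2 h4 h5 hf1; set iW := \int[P]_(w in A) W k w; set iZ := \int[P]_(w in A) Z k w.
set iZ' := \int[P]_(w in A) Z k.+1 w; set iU := \int[P]_(w in A) U k w.
have h6 : kap * psi k * ((1 - rho * a k) * iZ) = kap * psi k * iZ - (cL + 1) * b k * iZ.
  by rewrite -h3; ring.
rewrite mulrDr h6; set F := C0 * gam k * (1 + meanY k).
set p := u k `^ _; set kp1 := kap * psi k.
have -> : kp1 * F = kap * (psi k * F) by rewrite /kp1 mulrA.
lra.
Qed.

(* Young's inequality with the optimal t = K / meanW k stands for Cauchy-Schwarz. *)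
Let meanW_sqr K k : 0 < K -> meanY k <= K -> meanW k ^+ 2 <= K * meanU k.
Proof.
move=> K0 YK; have [->|W0n] := eqVneq (meanW k) 0.
  by rewrite expr0n /= mulr_ge0 ?(ltW K0).
have Wp : 0 < meanW k by rewrite lt_def W0n mW0.
pose t := K / meanW k.
have h : 2 * t * meanW k <= t ^+ 2 * meanU k + meanY k.
  rewrite /meanW /meanU /meanY -!RintegralZl// -RintegralD//; last exact: integrable_scale.
  apply: le_Rintegral => //; first exact: integrable_scale.
  by apply: integrable_addr => //; exact: integrable_scale.
have tW : t * meanW k = K by rewrite /t -mulrA mulVf ?mulr1.
have t2 : t ^+ 2 * meanW k ^+ 2 = K ^+ 2 by rewrite -exprMn tW.
have h' : K <= t ^+ 2 * meanU k by move: h; rewrite -mulrA tW; lra.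
have tp : 0 < t by rewrite divr_gt0.
have t2p : 0 < t ^+ 2 by rewrite exprn_gt0.
rewrite -(ler_pM2l t2p) t2 expr2 mulrCA ler_pM2l//.
Qed.

Let meanZ_sqr k : meanZ k ^+ 2 <= D2 * meanZ k.
Proof.
rewrite expr2 ler_wpM2r//; rewrite -[leRHS](Rintegral_prob_cst P).
by apply: le_Rintegral => //; exact: integrable_cst.
Qed.

(** The square of the mean of S is bounded by the gain [meanU k / 2 + meanZ k], which turns [stepS]
    into the quadratic recursion. *)
Lemma lyapunov_rate : exists2 A, 0 <= A &
  forall k, meanS k <= A * (k%:R + K1) `^ (- (1 / 4 - eps)).
Proof.
have [K K0 hK] := uniform_forcing; have [KS KS0 hS] := stepS.
pose r := kap * (beta / alpha).
have r0 : 0 <= r by apply: mulr_ge0; apply: ltW => //; exact: divr_gt0.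
have D20 : 0 <= D2.
  rewrite -[leRHS](Rintegral_prob_cst P); apply: le_trans (mZ0 0%N) _.
  by apply: le_Rintegral => //; exact: integrable_cst.
(* From [(w + v)^2 <= 2 w^2 + 2 v^2] with [w^2 <= K meanU] and [v^2 <= r^2 D2 meanZ]; the 4
   compensates for [meanU k / 2]. *)
pose C := 4 * K + 2 * r ^+ 2 * D2.
have rD : 0 <= r ^+ 2 * D2 by apply: mulr_ge0 => //; exact: sqr_ge0.
have Cp : 0 < C by rewrite /C; lra.
have mS k : meanS k = meanW k + kap * psi k * meanZ k by exact: SE.
have sS k : meanS k ^+ 2 <= C * (meanU k / 2 + meanZ k).
  have [YK _ _ _] := hK k; have h1 := meanW_sqr K0 YK; have h2 := meanZ_sqr k.
  have zr : kap * psi k * meanZ k <= r * meanZ k.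
    by apply: ler_wpM2r => //; apply: ler_wpM2l; [exact: ltW|exact: psi_le].
  have zr0 : 0 <= kap * psi k * meanZ k.
    by apply: mulr_ge0 => //; apply: mulr_ge0; exact: ltW.
  have h3 : (kap * psi k * meanZ k) ^+ 2 <= r ^+ 2 * (D2 * meanZ k).
    apply: le_trans (ler_wpM2l (sqr_ge0 r) h2); rewrite -exprMn.
    by rewrite ler_pXn2r// nnegrE// mulr_ge0.
  have h4 : 0 <= r ^+ 2 * D2 * meanU k by exact: mulr_ge0.
  have h5 : 0 <= K * meanZ k by apply: mulr_ge0 => //; exact: ltW.
  rewrite mS /C; have := sqr_ge0 (meanW k - kap * psi k * meanZ k).
  move: h1 h3; set v := kap * psi k * meanZ k; set w := meanW k; nra.
apply: (@quadratic_recursion_rate R meanS K1 (beta / C) KS eps) => //.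
- exact: divr_gt0.
- exact: ltW.
- by move=> k; exact: Rintegral_ge0.
move=> k; have h1 : meanS k.+1 <= meanS k - b k * (meanU k / 2 + meanZ k)
    + KS * u k `^ (- (5 / 4)) := hS k _ (@GTfull k).
apply: le_trans h1 _; rewrite lerD2r lerD2l lerN2 bE powRN -/(u k).
have p0 : 0 < (u k `^ (3 / 4 + eps))^-1 by rewrite invr_gt0 powR_gt0// (lt_le_trans _ (u1 k)).
set p := (u k `^ _)^-1 in p0 *.
have h := ler_wpM2l (ltW (mulr_gt0 beta_gt0 p0)) (sS k).
rewrite (_ : beta / C * p * meanS k ^+ 2 = C^-1 * (beta * p * meanS k ^+ 2)); last by ring.
by rewrite ler_pdivrMl//; move: h; lra.
Qed.

(** The convergence is proved for S, whose perturbation by Z has been absorbed, and W lies between 0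
    and S. *)
Lemma lyapunov_W_ae_cvg0 : {ae P, forall w, W k w @[k --> \oo] --> (0 : R)}.
Proof.
have [KS KS0 hS] := stepS; have [A A0 hA] := lyapunov_rate.
pose s k := KS * tau k.
have s0 k : 0 <= s k by apply: mulr_ge0 (tau0 k); exact: ltW.
have : {ae P, forall w, S k w @[k --> \oo] --> (0 : R)}; last first.
  move=> hae; apply: filterS hae => w hc; apply: (squeeze_cvgr _ (cvg_cst 0) hc); apply: nearW => k.
  by rewrite W0 /= lerDl; apply: mulr_ge0 => //; apply: mulr_ge0; exact: ltW.
apply: (@ae_cvg0 R disp T P Gn GT GS S s) => // [k|k|k B GB|e e0].
- by apply: measurable_funD => //; exact: measurable_funM.
- by apply: integrable_addr => //; exact: integrable_scale.
- apply: le_trans (hS k B GB) _.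
  have h1 : 0 <= b k * (\int[P]_(w in B) U k w / 2 + \int[P]_(w in B) Z k w).
    apply: mulr_ge0; first exact: ltW.
    by apply: addr_ge0; [apply: divr_ge0 => //; exact: Rintegral_ge0|exact: Rintegral_ge0].
  have h2 : KS * u k `^ (- (5 / 4)) <= KS * (tau k - tau k.+1).
    rewrite ler_pM2l//; apply: le_trans (tau_step k); exact: powRN_5_4_le.
  by rewrite /s; lra.
- have d0 : 0 < e / 2 / (A + 1) by rewrite !divr_gt0// ltr_wpDl.
  have d0' : 0 < e / 2 / KS by rewrite !divr_gt0.
  (* [powRN_vanishes] asks for an exponent between 0 and 1/4, which the rate exponent is too. *)
  have e4 : 0 < 1 / 4 - eps < 1 / 4 by case/andP: eps_bounds => h1 h2; apply/andP; split; lra.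
  have [m1 hm1] := powRN_vanishes e4 K1_ge1 d0; have [m2 hm2] := vanishing_tau d0'.
  exists (m1 + m2)%N; have := hm1 _ (leq_addr m2 m1); have := hm2 _ (leq_addl m1 m2).
  rewrite !ltr_pdivlMr ?ltr_wpDl//; have := hA (m1 + m2)%N; rewrite -/(meanS _) /s.
  set p := _ `^ _ => h1 h2 h3.
  have p0 : 0 <= p by exact: powR_ge0.
  lra.
Qed.

Lemma lyapunov_meanW_rate : exists2 A, 0 <= A &
  forall k, meanW k <= A * (k%:R + K1) `^ (- (1 / 4 - eps)).
Proof.
have [A A0 hA] := lyapunov_rate; exists A => // k; apply: le_trans (hA k).
rewrite /meanS (SE (@GTfull k)) lerDl; apply: mulr_ge0; last exact: Rintegral_ge0.
by apply: mulr_ge0; exact: ltW.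
Qed.

End LyapunovSystem.

(** * The stochastic iteration *)

Lemma lipschitz_continuous_row {R : realType} (n m : nat) (f : 'rV[R]_n -> 'rV[R]_m) (K : R) j :
  (forall u v, enorm (f u - f v) <= K * enorm (u - v)) ->
  continuous (fun u => f u 0 j).
Proof.
move=> fK; apply/continuous_subspace_setT/enorm_within_continuous => u _ e e0.
have K0 : 0 < `|K| + 1 by rewrite ltr_wpDl.
exists (e / (`|K| + 1)) => [|v _]; first by rewrite divr_gt0.
rewrite ltr_pdivlMr// => vu.
have -> : f v 0 j - f u 0 j = (f v - f u) 0 j by rewrite !mxE.
apply: le_trans (ler_coord_enorm _ _) _; apply: le_trans (fK _ _) _.
apply: le_trans (ltW vu); rewrite mulrC ler_wpM2l ?enorm_ge0//.
by rewrite (le_trans (ler_norm _))// lerDl.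
Qed.

(** * Adaptedness of the iterates *)

Section Adapted.
Context {R : realType} {d1 d2 : nat} (X : set 'rV[R]_d1)
  (gx : 'rV[R]_d1 -> 'rV[R]_d2 -> 'rV[R]_d1)
  (gy : 'rV[R]_d1 -> 'rV[R]_d2 -> 'rV[R]_d2) (L : R)
  (X_convex : convex_set X) (L_gt0 : 0 < L)
  (proj_ex : forall v, projection X v !=set0)
  (gxy_lip : forall x y x' y', X x -> X x' ->
     enorm2 (gx x y - gx x' y') (gy x y - gy x' y') <= L * enorm2 (x - x') (y - y')).
Context (a b : nat -> R) (disp : measure_display) (T : measurableType disp)
  (M : nat -> T -> 'rV[R]_d1) (M' : nat -> T -> 'rV[R]_d2)
  (x : nat -> T -> 'rV[R]_d1) (y : nat -> T -> 'rV[R]_d2)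
  (x0 : 'rV[R]_d1) (y0 : 'rV[R]_d2)
  (x0_in : X x0)
  (x_init : forall w, x 0%N w = x0) (y_init : forall w, y 0%N w = y0)
  (x_step : forall k w,
    projection X (x k w + a k *: (gx (x k w) (y k w) + M k.+1 w)) (x k.+1 w))
  (y_step : forall k w,
    y k.+1 w = y k w + b k *: (- gy (x k w) (y k w) + M' k.+1 w))
  (M_random : forall k, random_vector (M k.+1))
  (M'_random : forall k, random_vector (M' k.+1)).

(** The family generating [history], named separately because the measurable type of the past is
    built from its generators. *)
Definition generators k : set_system T :=
  vector_events (x 0%N) `|` vector_events (y 0%N) `|`
    \bigcup_(i in [set i | (0 < i <= k)%N]) (vector_events (M i) `|` vector_events (M' i)).

Local Notation Gn := generators.
Local Notation FT k := (g_sigma_algebraType (Gn k)).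

Lemma generators_subset k : Gn k `<=` Gn k.+1.
Proof.
apply: setUS => A [i /= /andP[i0 ik] Ai]; exists i => //=.
by rewrite i0 (leq_trans ik).
Qed.

Lemma history_subset k : <<s Gn k>> `<=` <<s Gn k.+1>>.
Proof. by apply: sub_sigma_algebra2; exact: generators_subset. Qed.

Lemma vector_events_measurable (d : nat) (Z : T -> 'rV[R]_d) :
  random_vector Z -> vector_events Z `<=` measurable.
Proof. by move=> mZ A [j _ [B mB <-]]; exact: mZ. Qed.

Lemma random_vector_cst (d : nat) (Z : T -> 'rV[R]_d) c :
  (forall w, Z w = c) -> random_vector Z.
Proof.
move=> Zc j; rewrite (_ : (fun w => _) = cst (c 0 j)); first exact: measurable_cst.
by apply/funext => w; rewrite Zc.
Qed.

Lemma history_measurable k : <<s Gn k>> `<=` measurable.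
Proof.
apply: smallest_sub; first exact: sigma_algebra_measurable.
move=> A [[|]|[[|i] //= _ [|]]]; apply: vector_events_measurable => //.
- exact: random_vector_cst x_init.
- exact: random_vector_cst y_init.
Qed.

Lemma generated_measurable_fun (d : nat) (Z : T -> 'rV[R]_d) k :
  vector_events Z `<=` Gn k -> forall j, measurable_fun [set: FT k] (fun w : FT k => Z w 0 j).
Proof. by move=> ZG j _ B mB; apply: sub_sigma_algebra; apply: ZG; exists j => //; exists B. Qed.

Lemma measurable_fun_next k (f : T -> R) :
  measurable_fun [set: FT k] (f : FT k -> R) ->
  measurable_fun [set: FT k.+1] (f : FT k.+1 -> R).
Proof. by move=> mf _ B mB; apply: history_subset; exact: (mf measurableT). Qed.

Lemma x_in k w : X (x k w).
Proof. by case: k => [|k]; [rewrite x_init|case: (x_step k w)]. Qed.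

(* The gradients are arbitrary off X; composed with the projection they become Lipschitz
   on the whole space, hence measurable along the iterates. *)
Let pr (v : 'rV[R]_d1) := xget 0 (projection X v).

Let prP v : projection X v (pr v).
Proof. by have [p pv] := proj_ex v; exact: (xgetPex 0 (ex_intro _ p pv)). Qed.

Let pr_id v : X v -> pr v = v.
Proof.
move=> Xv; apply: (projection_unique X_convex (prP v)); split => // u _.
by rewrite subrr enorm0 enorm_ge0.
Qed.

Let pr_lip u v : enorm (pr u - pr v) <= 1 * enorm (u - v).
Proof. by rewrite mul1r; exact: projection_nonexpansive X_convex (prP u) (prP v). Qed.

(** Both gradients as one map of concatenated rows, so that the joint Lipschitz bound covers every
    coordinate at once. *)
Let gpair (z : 'rV[R]_(d1 + d2)) : 'rV[R]_(d1 + d2) :=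
  row_mx (gx (pr (lsubmx z)) (rsubmx z)) (gy (pr (lsubmx z)) (rsubmx z)).

Let gpair_lip u v : enorm (gpair u - gpair v) <= L * enorm (u - v).
Proof.
rewrite /gpair opp_row_mx add_row_mx -enorm2E.
apply: le_trans (gxy_lip _ _ (prP _).1 (prP _).1) _.
rewrite ler_pM2l// -[u in leRHS]hsubmxK -[v in leRHS]hsubmxK opp_row_mx add_row_mx.
rewrite -enorm2E -(ler_pXn2r (n := 2)) ?nnegrE ?enorm2_ge0// !enorm2_sqr lerD2r.
rewrite ler_pXn2r ?nnegrE ?enorm_ge0//.
by rewrite (le_trans (pr_lip _ _))// mul1r.
Qed.

(** By induction, each iterate is a continuous function of its predecessors and of the newest noise;
    uniqueness turns the projection relation into the function [pr]. *)
Lemma iterates_adapted k :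
  (forall j, measurable_fun [set: FT k] (fun w : FT k => x k w 0 j)) /\
  (forall j, measurable_fun [set: FT k] (fun w : FT k => y k w 0 j)).
Proof.
elim: k => [|k [IHx IHy]].
  by split => j; apply: generated_measurable_fun => A hA; left; [left|right].
have mx' j := measurable_fun_next (IHx j).
have my' j := measurable_fun_next (IHy j).
have mM : forall j, measurable_fun [set: FT k.+1] (fun w : FT k.+1 => M k.+1 w 0 j).
  apply: generated_measurable_fun => A hA; right; exists k.+1; first by rewrite /= leqnn.
  by left.
have mM' : forall j, measurable_fun [set: FT k.+1] (fun w : FT k.+1 => M' k.+1 w 0 j).
  apply: generated_measurable_fun => A hA; right; exists k.+1; first by rewrite /= leqnn.
  by right.
have mg (j : 'I_(d1 + d2)) : measurable_fun [set: FT k.+1]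
    (fun w : FT k.+1 => gpair (row_mx (x k w) (y k w)) 0 j).
  apply: (@measurable_continuous_row _ _ _ _ (fun z => gpair z 0 j)).
    exact: lipschitz_continuous_row gpair_lip.
  move=> i; rewrite -(fintype.splitK i); case: (fintype.split i) => i' /=.
    under eq_fun do rewrite row_mxEl; exact: mx'.
  under eq_fun do rewrite row_mxEr; exact: my'.
have gxE w j : gx (x k w) (y k w) 0 j = gpair (row_mx (x k w) (y k w)) 0 (lshift d2 j).
  by rewrite /gpair row_mxEl row_mxKl row_mxKr pr_id//; exact: x_in.
have gyE w j : gy (x k w) (y k w) 0 j = gpair (row_mx (x k w) (y k w)) 0 (rshift d1 j).
  by rewrite /gpair row_mxEr row_mxKl row_mxKr pr_id//; exact: x_in.
split=> j.
  have -> : (fun w : FT k.+1 => x k.+1 w 0 j) =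
      (fun v => pr v 0 j) \o (fun w => x k w + a k *: (gx (x k w) (y k w) + M k.+1 w)).
    apply/funext => w /=.
    by rewrite (projection_unique X_convex (x_step k w) (prP _)).
  apply: measurable_continuous_row; first exact: lipschitz_continuous_row pr_lip.
  move=> i; under eq_fun do rewrite !mxE gxE.
  by apply: measurable_funD => //; apply: measurable_funM => //; exact: measurable_funD.
under eq_fun do rewrite y_step !mxE gyE.
apply: measurable_funD => //; apply: measurable_funM => //; apply: measurable_funD => //.
exact: measurableT_comp.
Qed.

End Adapted.

Lemma measurable_enorm_sqr {R : realType} d (T : measurableType d) (n : nat)
    (Z : T -> 'rV[R]_n) :
  (forall j, measurable_fun [set: T] (fun w => Z w 0 j)) ->
  measurable_fun [set: T] (fun w => enorm (Z w) ^+ 2).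
Proof.
move=> mZ; under eq_fun do rewrite enorm_sqr; apply: measurable_sum => j.
exact: measurable_funM.
Qed.

(** * Integrated Lyapunov inequalities along the iteration *)

Section Stochastic.
Context {R : realType} {d1 d2 : nat} (X : set 'rV[R]_d1)
  (gx : 'rV[R]_d1 -> 'rV[R]_d2 -> 'rV[R]_d1)
  (gy : 'rV[R]_d1 -> 'rV[R]_d2 -> 'rV[R]_d2)
  (xs : 'rV[R]_d2 -> 'rV[R]_d1) (phi : 'rV[R]_d2 -> R)
  (dphi : 'rV[R]_d2 -> 'rV[R]_d2) (yb : 'rV[R]_d2) (L rho Lp G Dm : R)
  (X_convex : convex_set X) (L_gt0 : 0 < L) (rho_gt0 : 0 < rho) (Lp_gt0 : 0 < Lp)
  (G_gt0 : 0 < G)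
  (xs_in : forall y, X (xs y))
  (xs_monotone : forall x y, X x ->
     dotr (gx x y) (x - xs y) <= - rho * enorm (x - xs y) ^+ 2)
  (xs_lip : forall y y', enorm (xs y - xs y') <= L / rho * enorm (y - y'))
  (gx_growth : forall x y, X x -> enorm (gx x y) ^+ 2 <= G * (1 + enorm (y - yb) ^+ 2))
  (gy_growth : forall x y, X x -> enorm (gy x y) ^+ 2 <= G * (1 + enorm (y - yb) ^+ 2))
  (xy_growth : forall x y, X x ->
     1 + enorm x ^+ 2 + enorm y ^+ 2 <= G * (1 + enorm (y - yb) ^+ 2))
  (gy_lip : forall x y, X x -> enorm (dphi y - gy x y) <= L * enorm (x - xs y))
  (phi_lower : forall y y', phi y + dotr (dphi y) (y' - y) <= phi y')
  (phi_upper : forall y y',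
     phi y' <= phi y + dotr (dphi y) (y' - y) + Lp * enorm (y' - y) ^+ 2)
  (phi_min : forall y, phi yb <= phi y)
  (dphi_yb : dphi yb = 0)
  (dphi_lip : forall y y', enorm (dphi y - dphi y') <= Lp * enorm (y - y'))
  (phi_cont : continuous phi)
  (X_diam : forall u v, X u -> X v -> enorm (u - v) <= Dm)
  (proj_ex : forall v, projection X v !=set0)
  (gxy_lip : forall x y x' y', X x -> X x' ->
     enorm2 (gx x y - gx x' y') (gy x y - gy x' y') <= L * enorm2 (x - x') (y - y')).
Context (eps alpha beta K1 : R)
  (eps_bounds : 0 < eps < 1 / 4)
  (alpha_gt0 : 0 < alpha) (beta_gt0 : 0 < beta) (K1_ge1 : 1 <= K1)
  (a b : nat -> R)
  (aE : forall k, a k = alpha / (k%:R + K1) `^ (1 / 2 + 66 / 100 * eps))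
  (bE : forall k, b k = beta / (k%:R + K1) `^ (3 / 4 + eps))
  (disp : measure_display) (T : measurableType disp) (P : probability T R)
  (M : nat -> T -> 'rV[R]_d1) (M' : nat -> T -> 'rV[R]_d2)
  (x : nat -> T -> 'rV[R]_d1) (y : nat -> T -> 'rV[R]_d2)
  (x0 : 'rV[R]_d1) (y0 : 'rV[R]_d2)
  (x0_in : X x0)
  (x_init : forall w, x 0%N w = x0) (y_init : forall w, y 0%N w = y0)
  (x_step : forall k w,
    projection X (x k w + a k *: (gx (x k w) (y k w) + M k.+1 w)) (x k.+1 w))
  (y_step : forall k w,
    y k.+1 w = y k w + b k *: (- gy (x k w) (y k w) + M' k.+1 w))
  (M_random : forall k, random_vector (M k.+1))
  (M'_random : forall k, random_vector (M' k.+1))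
  (M_mean0 : forall k j,
    is_cond_exp P (history (x 0%N) (y 0%N) M M' k)
      (fun w => M k.+1 w 0 j) (cst 0))
  (M'_mean0 : forall k j,
    is_cond_exp P (history (x 0%N) (y 0%N) M M' k)
      (fun w => M' k.+1 w 0 j) (cst 0))
  (c2 : R) (c2_gt0 : 0 < c2)
  (noise_var : forall k, exists V : T -> R,
    is_cond_exp P (history (x 0%N) (y 0%N) M M' k)
      (fun w => enorm (M k.+1 w) ^+ 2 + enorm (M' k.+1 w) ^+ 2) V /\
    {ae P, forall w,
      V w <= c2 * (1 + enorm (x k w) ^+ 2 + enorm (y k w) ^+ 2)}).


Local Notation Gn := (generators M M' x y).
Local Notation FT k := (g_sigma_algebraType (Gn k)).

Definition lyapY k w := enorm (y k w - yb) ^+ 2.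
Definition lyapZ k w := enorm (x k w - xs (y k w)) ^+ 2.
Definition lyapW k w := phi (y k w) - phi yb.
Definition grad2 k w := enorm (dphi (y k w)) ^+ 2.
Definition noise2 k w := enorm (M k.+1 w) ^+ 2 + enorm (M' k.+1 w) ^+ 2.
Local Notation Y := lyapY.
Local Notation Z := lyapZ.
Local Notation W := lyapW.
Local Notation N := noise2.
Local Notation U := grad2.

Let GT k : <<s Gn k>> `<=` measurable.
Proof. by apply: history_measurable; [exact: x_init|exact: y_init| |]. Qed.

Let GS k : <<s Gn k>> `<=` <<s Gn k.+1>>.
Proof. exact: history_subset. Qed.

Let mT k (f : T -> R) : measurable_fun [set: FT k] (f : FT k -> R) -> measurable_fun [set: T] f.
Proof. exact: sub_measurable_fun (@GT k) _. Qed.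

Let xX k w : X (x k w).
Proof. exact: (x_in x0_in x_init x_step). Qed.

Let adx k j : measurable_fun [set: FT k] (fun w : FT k => x k w 0 j).
Proof.
by have [h _] := iterates_adapted X_convex L_gt0 proj_ex gxy_lip x0_in x_init x_step y_step k.
Qed.

Let ady k j : measurable_fun [set: FT k] (fun w : FT k => y k w 0 j).
Proof.
by have [_ h] := iterates_adapted X_convex L_gt0 proj_ex gxy_lip x0_in x_init x_step y_step k.
Qed.

Let adyb k j : measurable_fun [set: FT k] (fun w : FT k => (y k w - yb) 0 j).
Proof. by under eq_fun do rewrite !mxE; exact: measurable_funD. Qed.

Let adxs k j : measurable_fun [set: FT k] (fun w : FT k => (x k w - xs (y k w)) 0 j).
Proof.
under eq_fun do rewrite !mxE; apply: measurable_funB => //.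
by apply: (measurable_continuous_row (f := fun v => xs v 0 j)) => //;
  exact: lipschitz_continuous_row xs_lip.
Qed.

Let addphi k j : measurable_fun [set: FT k] (fun w : FT k => dphi (y k w) 0 j).
Proof.
by apply: (measurable_continuous_row (f := fun v => dphi v 0 j)) => //;
  exact: lipschitz_continuous_row dphi_lip.
Qed.

Lemma lyapY_adapted k : measurable_fun [set: FT k] (Y k : FT k -> R).
Proof. exact: measurable_enorm_sqr. Qed.

Lemma lyapZ_adapted k : measurable_fun [set: FT k] (Z k : FT k -> R).
Proof. exact: measurable_enorm_sqr. Qed.

Lemma grad2_adapted k : measurable_fun [set: FT k] (U k : FT k -> R).
Proof. exact: measurable_enorm_sqr. Qed.

Lemma lyapW_adapted k : measurable_fun [set: FT k] (W k : FT k -> R).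
Proof. by apply: measurable_funB => //; exact: (measurable_continuous_row (f := phi)). Qed.

Let Y0 k w : 0 <= Y k w. Proof. exact: sqr_ge0. Qed.
Let Z0 k w : 0 <= Z k w. Proof. exact: sqr_ge0. Qed.
Let U0 k w : 0 <= U k w. Proof. exact: sqr_ge0. Qed.
Let N0 k w : 0 <= N k w. Proof. by rewrite addr_ge0 ?sqr_ge0. Qed.
Let W0 k w : 0 <= W k w. Proof. by rewrite subr_ge0. Qed.

Lemma lyapZ_le k w : Z k w <= Dm ^+ 2.
Proof.
rewrite ler_pXn2r ?nnegrE ?enorm_ge0//; first exact: X_diam.
exact: le_trans (enorm_ge0 _) (X_diam (xX k w) (xs_in (y k w))).
Qed.

Lemma lyapW_le k w : W k w <= Lp * Y k w.
Proof.
have := phi_upper yb (y k w); rewrite dphi_yb -(scale0r (0 : 'rV[R]_d2)) dotrZl mul0r addr0.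
by rewrite /lyapW /lyapY; lra.
Qed.

Lemma grad2_le k w : U k w <= Lp ^+ 2 * Y k w.
Proof.
rewrite -exprMn ler_pXn2r ?nnegrE ?enorm_ge0 ?mulr_ge0 ?enorm_ge0 ?(ltW Lp_gt0)//.
by have := dphi_lip (y k w) yb; rewrite dphi_yb subr0.
Qed.

Lemma noise2_integrable k : P.-integrable [set: T] (EFin \o N k).
Proof. by have [V [[]]] := noise_var k. Qed.

Let a_gt0 k : 0 < a k. Proof. by rewrite aE; exact: step_a_gt0. Qed.
Let b_gt0 k : 0 < b k. Proof. by rewrite bE; exact: step_b_gt0. Qed.
Let a_le k : a k <= alpha. Proof. by rewrite aE; exact: step_a_le. Qed.

(** Starts from a deterministic point; one step preserves integrability because squared gradients
    grow like [1 + Y] and the noise has an integrable square. *)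
Lemma lyapY_integrable k : P.-integrable [set: T] (EFin \o Y k).
Proof.
elim: k => [|k IH].
  apply: (@integrable_dominated _ _ _ P _ (fun=> enorm (y0 - yb) ^+ 2)).
  - exact: mT (@lyapY_adapted 0%N).
  - exact: integrable_cst.
  - by move=> w; rewrite /lyapY y_init ger0_norm ?sqr_ge0.
pose Bd w := 2 * Y k w + 2 * b k ^+ 2 * (2 * G * (1 + Y k w) + 2 * N k w).
apply: (@integrable_dominated _ _ _ P _ Bd).
- exact: mT (@lyapY_adapted k.+1).
- apply: integrable_addr; first exact: integrable_scale.
  apply: integrable_scale; apply: integrable_addr; apply: integrable_scale => //.
    by apply: integrable_addr => //; exact: integrable_cst.
  exact: noise2_integrable.
- move=> w; rewrite ger0_norm// /Bd /lyapY y_step addrAC.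
  apply: le_trans (enorm_sqrD2 _ _) _; rewrite lerD2l enorm_sqrZ mulrA ler_wpM2l//.
    by rewrite mulr_ge0 ?sqr_ge0.
  apply: le_trans (enorm_sqrD2 _ _) _; rewrite enormN.
  have := gy_growth (y k w) (xX k w); rewrite -/(Y k w) /noise2.
  have : 0 <= enorm (M k.+1 w) ^+ 2 by exact: sqr_ge0.
  lra.
Qed.

Definition lyapB k w := 1 + Y k w.
Local Notation B := lyapB.

Lemma lyapB_integrable k : P.-integrable [set: T] (EFin \o B k).
Proof. by apply: integrable_addr; [exact: integrable_cst|exact: lyapY_integrable]. Qed.

Lemma lyapZ_integrable k : P.-integrable [set: T] (EFin \o Z k).
Proof.
apply: (@integrable_dominated _ _ _ P _ (fun=> Dm ^+ 2)).
- exact: mT (@lyapZ_adapted k).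
- exact: integrable_cst.
- by move=> w; rewrite ger0_norm// lyapZ_le.
Qed.

Lemma lyapW_integrable k : P.-integrable [set: T] (EFin \o W k).
Proof.
apply: (@integrable_dominated _ _ _ P _ (fun w => Lp * Y k w)).
- exact: mT (@lyapW_adapted k).
- by apply: integrable_scale; exact: lyapY_integrable.
- by move=> w; rewrite ger0_norm// lyapW_le.
Qed.

Lemma grad2_integrable k : P.-integrable [set: T] (EFin \o U k).
Proof.
apply: (@integrable_dominated _ _ _ P _ (fun w => Lp ^+ 2 * Y k w)).
- exact: mT (@grad2_adapted k).
- by apply: integrable_scale; exact: lyapY_integrable.
- by move=> w; rewrite ger0_norm// grad2_le.
Qed.

Lemma noise2_le k A : <<s Gn k>> A ->
  \int[P]_(w in A) N k w <= c2 * G * \int[P]_(w in A) B k w.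
Proof.
move=> GA; have mA := GT GA; have [V [VN VB]] := noise_var k.
pose Q w := c2 * (1 + enorm (x k w) ^+ 2 + enorm (y k w) ^+ 2).
have Qi : P.-integrable [set: T] (EFin \o Q).
  apply: (@integrable_dominated _ _ _ P _ (fun w => c2 * G * B k w)).
  - apply: measurable_funM => //; apply: measurable_funD.
      apply: measurable_funD => //; apply: measurable_enorm_sqr => j; apply: (@mT k); exact: adx.
    by apply: measurable_enorm_sqr => j; apply: (@mT k); exact: ady.
  - by apply: integrable_scale; exact: lyapB_integrable.
  - move=> w; rewrite ger0_norm; last by rewrite mulr_ge0 ?(ltW c2_gt0)// !addr_ge0 ?sqr_ge0.
    by rewrite -mulrA ler_pM2l// xy_growth.
apply: le_trans (cond_exp_le VN VB Qi GA mA) _.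
rewrite -RintegralZl//; last exact: (integrableS measurableT) (lyapB_integrable k).
apply: le_Rintegral => //.
- exact: (integrableS measurableT) Qi.
- by apply: (integrableS measurableT) => //; apply: integrable_scale; exact: lyapB_integrable.
- by move=> w _; rewrite -mulrA ler_pM2l// xy_growth.
Qed.

Let q k := b k ^+ 2 / a k.
Let gam k := a k ^+ 2 + q k.
Let G' := 2 * G + 2.
Let q0 k : 0 < q k. Proof. by rewrite divr_gt0 ?exprn_gt0. Qed.

(** The constants of the three pathwise inequalities, with [alpha] as the upper bound on the fast
    steps. *)
Let cY := L ^+ 2 / rho + alpha * G'.
Let cZ := (1 + rho * alpha) * G' + (alpha + rho^-1) * (L / rho) ^+ 2 * G'.
Let cW := Lp * G'.

Let G'0 : 0 < G'. Proof. by have := G_gt0; rewrite /G'; lra. Qed.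
Let cY0 : 0 <= cY. Proof. by have h := G'0; rewrite /cY; nonneg. Qed.
Let cZ0 : 0 <= cZ. Proof. by have h := G'0; rewrite /cZ; nonneg. Qed.
Let cW0 : 0 <= cW. Proof. by have h := G'0; rewrite /cW; nonneg. Qed.
Let G2 : 0 <= 1 + c2 * G. Proof. by nonneg. Qed.

Lemma expected_stepY k A : <<s Gn k>> A ->
  \int[P]_(w in A) Y k.+1 w <= \int[P]_(w in A) (Y k w + rho * a k * Z k w)
    + cY * q k * (1 + c2 * G) * \int[P]_(w in A) B k w.
Proof.
move=> GA.
apply: (expected_step (K := (2 * b k) ^+ 2) (@GT k) (@M'_mean0 k)
  (g := fun w => (2 * b k) *: (y k w - yb)) (N := N k)) => //.
- by move=> j; under eq_fun do rewrite mxE; apply: measurable_funM.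
- by move=> w; rewrite lerDr sqr_ge0.
- by move=> w; rewrite enorm_sqrZ ler_wpM2l ?sqr_ge0// lerDr.
- exact: noise2_integrable.
- exact: lyapB_integrable.
- exact: lyapY_integrable.
- apply: integrable_addr; first exact: lyapY_integrable.
  by apply: integrable_scale; exact: lyapZ_integrable.
- by rewrite mulr_ge0 ?cY0// ltW.
- exact: noise2_le.
- move=> w; rewrite {1}/lyapY y_step.
  exact: (one_step_Y L_gt0 rho_gt0 G_gt0 gy_growth gy_lip phi_lower phi_min
    (y k w) (M k.+1 w) (M' k.+1 w) (xX k w) (a_gt0 k) (a_le k) (b_gt0 k)).
Qed.

Lemma expected_stepZ k A : <<s Gn k>> A ->
  \int[P]_(w in A) Z k.+1 w <= \int[P]_(w in A) ((1 - rho * a k) * Z k w)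
    + cZ * gam k * (1 + c2 * G) * \int[P]_(w in A) B k w.
Proof.
move=> GA.
apply: (expected_step (K := (2 * a k * (1 + rho * a k)) ^+ 2 * Dm ^+ 2) (@GT k) (@M_mean0 k)
  (g := fun w => (2 * a k * (1 + rho * a k)) *: (x k w - xs (y k w))) (N := N k)) => //.
- by move=> j; under eq_fun do rewrite mxE; apply: measurable_funM.
- by move=> w; rewrite lerDl sqr_ge0.
- move=> w; rewrite enorm_sqrZ -[leRHS]mulrA ler_wpM2l ?sqr_ge0//.
  apply: le_trans (lyapZ_le k w) _; rewrite ler_peMr ?sqr_ge0// lerDl.
  exact: Y0.
- exact: noise2_integrable.
- exact: lyapB_integrable.
- exact: lyapZ_integrable.
- by apply: integrable_scale; exact: lyapZ_integrable.
- by rewrite mulr_ge0 ?cZ0// addr_ge0 ?sqr_ge0// ltW.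
- exact: noise2_le.
- move=> w; rewrite {1}/lyapZ y_step.
  exact: (one_step_Z X_convex L_gt0 rho_gt0 G_gt0 xs_in xs_monotone xs_lip gx_growth
    gy_growth alpha_gt0 (M' k.+1 w) (xX k w) (a_gt0 k) (a_le k) (b_gt0 k) (x_step k w)).
Qed.

Lemma expected_stepW k A : <<s Gn k>> A ->
  \int[P]_(w in A) W k.+1 w <=
    \int[P]_(w in A) (W k w + (L ^+ 2 / 2 * b k * Z k w + - (b k / 2) * U k w))
    + cW * b k ^+ 2 * (1 + c2 * G) * \int[P]_(w in A) B k w.
Proof.
move=> GA.
apply: (expected_step (K := b k ^+ 2 * Lp ^+ 2) (@GT k) (@M'_mean0 k)
  (g := fun w => b k *: dphi (y k w)) (N := N k)) => //.
- by move=> j; under eq_fun do rewrite mxE; apply: measurable_funM.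
- by move=> w; rewrite lerDr sqr_ge0.
- move=> w; rewrite enorm_sqrZ -[leRHS]mulrA ler_wpM2l ?sqr_ge0//.
  apply: le_trans (grad2_le k w) _; rewrite ler_wpM2l ?sqr_ge0// lerDr//.
- exact: noise2_integrable.
- exact: lyapB_integrable.
- exact: lyapW_integrable.
- apply: integrable_addr; first exact: lyapW_integrable.
  apply: integrable_addr; apply: integrable_scale; first exact: lyapZ_integrable.
  exact: grad2_integrable.
- by rewrite mulr_ge0 ?cW0// sqr_ge0.
- exact: noise2_le.
- move=> w; rewrite {1}/lyapW y_step.
  have := one_step_phi L_gt0 Lp_gt0 G_gt0 gy_growth gy_lip phi_upper
    (y k w) (M k.+1 w) (M' k.+1 w) (xX k w) (b_gt0 k).
  rewrite -/(lyapW k w) -/(grad2 k w) -/(lyapZ k w) /cW /G' /lyapB /lyapY /noise2 /lyapW.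
  lra.
Qed.

Let inA k A f : <<s Gn k>> A -> P.-integrable [set: T] (EFin \o f) -> P.-integrable A (EFin \o f).
Proof. by move=> /GT mA fi; exact: (integrableS measurableT). Qed.

Lemma le_Rintegral_setT A (f : T -> R) : measurable A -> (forall w, 0 <= f w) ->
  P.-integrable [set: T] (EFin \o f) -> \int[P]_(w in A) f w <= \int[P]_w f w.
Proof.
move=> mA f0 fi; rewrite -(setUv A) Rintegral_setU//.
- by rewrite lerDl; apply: Rintegral_ge0.
- exact: measurableC.
- by rewrite setUv.
- by apply/disj_setPS; rewrite setICr.
Qed.

Definition meanY k := \int[P]_w Y k w.

Let mY0 k : 0 <= meanY k. Proof. by apply: Rintegral_ge0. Qed.

Lemma lyapB_le k A : <<s Gn k>> A -> \int[P]_(w in A) B k w <= 1 + meanY k.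
Proof.
move=> GA; have mA := GT GA.
apply: le_trans (le_Rintegral_setT mA _ (lyapB_integrable k)) _.
  by move=> w; rewrite addr_ge0.
rewrite RintegralD//; last exact: lyapY_integrable.
  by rewrite Rintegral_prob_cst.
exact: integrable_cst.
Qed.

Let C0 := (cY + cZ + cW) * (1 + c2 * G).
Let C00 : 0 <= C0.
Proof.
have h1 := cY0; have h2 := cZ0; have h3 := cW0.
by apply: mulr_ge0; [lra|exact: G2].
Qed.

(** Enlarging the integral of [1 + Y] from the event to the whole space makes the forcing
    independent of the event. *)
Let forcing_le c t s k A : 0 <= c -> c <= cY + cZ + cW -> 0 <= t -> t <= s ->
  <<s Gn k>> A ->
  c * t * (1 + c2 * G) * \int[P]_(w in A) B k w <= C0 * s * (1 + meanY k).
Proof.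
move=> c0 cC t0 ts GA; apply: ler_pM.
- by apply: mulr_ge0; [exact: mulr_ge0|exact: G2].
- by apply: Rintegral_ge0 => w _; rewrite addr_ge0.
- have G20 := G2; rewrite /C0 [leRHS]mulrAC ler_wpM2r//.
  by apply: ler_pM.
- exact: lyapB_le.
Qed.

Lemma linearY k A : <<s Gn k>> A ->
  \int[P]_(w in A) Y k.+1 w <= \int[P]_(w in A) Y k w
    + rho * a k * \int[P]_(w in A) Z k w + C0 * gam k * (1 + meanY k).
Proof.
move=> GA; have mA := GT GA; apply: le_trans (expected_stepY GA) _; apply: lerD.
  rewrite RintegralD//; last by apply: (inA GA); apply: integrable_scale; exact: lyapZ_integrable.
    by rewrite RintegralZl//; apply: (inA GA); exact: lyapZ_integrable.
  by apply: (inA GA); exact: lyapY_integrable.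
apply: forcing_le => //; first by have := cZ0; have := cW0; lra.
  exact: ltW.
by rewrite /gam lerDr sqr_ge0.
Qed.

Lemma linearZ k A : <<s Gn k>> A ->
  \int[P]_(w in A) Z k.+1 w <= (1 - rho * a k) * \int[P]_(w in A) Z k w
    + C0 * gam k * (1 + meanY k).
Proof.
move=> GA; have mA := GT GA; apply: le_trans (expected_stepZ GA) _; apply: lerD.
  by rewrite RintegralZl//; apply: (inA GA); exact: lyapZ_integrable.
apply: forcing_le => //; first by have := cY0; have := cW0; lra.
by rewrite /gam addr_ge0 ?sqr_ge0// ltW.
Qed.

Lemma linearW k A : <<s Gn k>> A ->
  \int[P]_(w in A) W k.+1 w <= \int[P]_(w in A) W k w
    + L ^+ 2 / 2 * b k * \int[P]_(w in A) Z k w - b k / 2 * \int[P]_(w in A) U k w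
    + C0 * b k ^+ 2 * (1 + meanY k).
Proof.
move=> GA; have mA := GT GA; apply: le_trans (expected_stepW GA) _; apply: lerD.
  have iW := inA GA (lyapW_integrable k).
  have iZ := inA GA (lyapZ_integrable k).
  have iU := inA GA (grad2_integrable k).
  have iZ' := inA GA (integrable_scale (L ^+ 2 / 2 * b k) (lyapZ_integrable k)).
  have iU' := inA GA (integrable_scale (- (b k / 2)) (grad2_integrable k)).
  have iZU := inA GA (integrable_addr
    (integrable_scale (L ^+ 2 / 2 * b k) (lyapZ_integrable k))
    (integrable_scale (- (b k / 2)) (grad2_integrable k))).
  rewrite (RintegralD mA iW iZU) (RintegralD mA iZ' iU') !RintegralZl//.
  by rewrite mulNr addrA.
by apply: forcing_le; rewrite ?sqr_ge0//; have := cY0; have := cZ0; lra.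
Qed.

(** Convexity gives [W <= <dphi, y - yb>]; for [t > 0] Young replaces the bound [W^2 <= U Y] by a
    form that is linear in U and Y and can be integrated. *)
Lemma lyapW_young k w t : 2 * t * W k w <= t ^+ 2 * U k w + Y k w.
Proof.
have [t0|t0] := leP t 0.
  have h : t * W k w <= 0 by rewrite mulr_le0_ge0.
  have : 0 <= t ^+ 2 * U k w by rewrite mulr_ge0 ?sqr_ge0.
  by have := Y0 k w; lra.
have h1 := phi_lower (y k w) yb; rewrite -(opprB (y k w) yb) dotrNr in h1.
have := dotr_young (t *: dphi (y k w)) (y k w - yb) ltr01.
rewrite invr1 !mul1r enorm_sqrZ dotrZl -/(Y k w) -/(U k w) => h2.
have h3 : t * W k w <= t * dotr (dphi (y k w)) (y k w - yb).
  by rewrite ler_pM2l// /lyapW; lra.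
lra.
Qed.

Lemma grad2_le_lyapW k w : U k w <= 4 * Lp * W k w.
Proof. exact: descent_gradient_bound Lp_gt0 (phi_upper _) phi_min. Qed.

Lemma iterates_limits :
  [/\ {ae P, forall w, exists K, forall k, Y k w <= K},
      {ae P, forall w, Z k w @[k --> \oo] --> (0 : R)},
      {ae P, forall w, W k w @[k --> \oo] --> (0 : R)} &
      exists2 A, 0 <= A &
        forall k, (\int[P]_w (U k w)%:E <= (A * (k%:R + K1) `^ (- (1 / 4 - eps)))%:E)%E].
Proof.
have cL0 : 0 <= L ^+ 2 / 2 by rewrite divr_ge0 ?sqr_ge0.
have iY := lyapY_integrable; have iZ := lyapZ_integrable; have iW := lyapW_integrable.
have iU := grad2_integrable.
split.
- exact: (lyapunov_ae_bounded (@GT) (@GS) Y0 Z0 lyapY_adapted lyapZ_adapted iY iZ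
    eps_bounds alpha_gt0 beta_gt0 K1_ge1 C00 aE bE (@linearY) (@linearZ)).
- exact: (lyapunov_Z_ae_cvg0 (@GT) (@GS) Y0 Z0 lyapZ_adapted iZ
    eps_bounds alpha_gt0 beta_gt0 K1_ge1 rho_gt0 C00 aE bE (@linearY) (@linearZ)).
- exact: (lyapunov_W_ae_cvg0 (@GT) (@GS) Y0 Z0 W0 U0 lyapZ_adapted lyapW_adapted iY iZ iW iU
    eps_bounds alpha_gt0 beta_gt0 K1_ge1 rho_gt0 C00 cL0 aE bE lyapZ_le lyapW_young
    (@linearY) (@linearZ) (@linearW)).
- have [A A0 hA] := lyapunov_meanW_rate (@GT) (@GS) Y0 Z0 W0 U0 iY iZ iW iU
    eps_bounds alpha_gt0 beta_gt0 K1_ge1 rho_gt0 C00 cL0 aE bE lyapZ_le lyapW_young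
    (@linearY) (@linearZ) (@linearW).
  have L4 : 0 <= 4 * Lp by rewrite mulr_ge0// ltW.
  exists (4 * Lp * A) => [|k]; first exact: mulr_ge0.
  rewrite -(mulrA (4 * Lp)) -[leLHS]fineK ?lee_fin; last exact: (integrable_fin_num _ (iU k)).
  apply: le_trans (ler_wpM2l L4 (hA k)); rewrite -RintegralZl//.
  apply: le_Rintegral => //; first exact: integrable_scale.
  by move=> w _; exact: grad2_le_lyapW.
Qed.

End Stochastic.

Theorem corollary5p2 (R : realType) (d1 d2 : nat)
  (X : set 'rV[R]_d1) (H : 'rV[R]_d1 -> 'rV[R]_d2 -> R)
  (gx : 'rV[R]_d1 -> 'rV[R]_d2 -> 'rV[R]_d1)
  (gy : 'rV[R]_d1 -> 'rV[R]_d2 -> 'rV[R]_d2) (L rho : R)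
  (X_nonempty : X !=set0) (X_closed : closed X) (X_convex : convex_set X)
  (X_bounded : bounded_diameter X)
  (L_gt0 : 0 < L) (rho_gt0 : 0 < rho)
  (H_smooth : smooth_on X L H gx gy)
  (H_concave : forall y, strongly_concave X rho (fun x => H x y))
  (H_convex : forall x, X x -> convex_function [set: 'rV[R]_d2] (H x))
  (saddle_nonempty : saddle_points X H !=set0)
  (eps alpha beta K1 : R)
  (eps_bounds : 0 < eps < 1 / 4)
  (alpha_gt0 : 0 < alpha) (beta_gt0 : 0 < beta) (K1_ge1 : 1 <= K1)
  (a b : nat -> R)
  (aE : forall k, a k = alpha / (k%:R + K1) `^ (1 / 2 + 66 / 100 * eps))
  (bE : forall k, b k = beta / (k%:R + K1) `^ (3 / 4 + eps))
  (disp : measure_display) (T : measurableType disp) (P : probability T R)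
  (M : nat -> T -> 'rV[R]_d1) (M' : nat -> T -> 'rV[R]_d2)
  (x : nat -> T -> 'rV[R]_d1) (y : nat -> T -> 'rV[R]_d2)
  (x0 : 'rV[R]_d1) (y0 : 'rV[R]_d2)
  (x0_in : X x0)
  (x_init : forall w, x 0%N w = x0) (y_init : forall w, y 0%N w = y0)
  (x_step : forall k w,
    projection X (x k w + a k *: (gx (x k w) (y k w) + M k.+1 w)) (x k.+1 w))
  (y_step : forall k w,
    y k.+1 w = y k w + b k *: (- gy (x k w) (y k w) + M' k.+1 w))
  (M_random : forall k, random_vector (M k.+1))
  (M'_random : forall k, random_vector (M' k.+1))
  (M_mean0 : forall k j,
    is_cond_exp P (history (x 0%N) (y 0%N) M M' k)
      (fun w => M k.+1 w 0 j) (cst 0))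
  (M'_mean0 : forall k j,
    is_cond_exp P (history (x 0%N) (y 0%N) M M' k)
      (fun w => M' k.+1 w 0 j) (cst 0))
  (c2 : R) (c2_gt0 : 0 < c2)
  (noise_var : forall k, exists V : T -> R,
    is_cond_exp P (history (x 0%N) (y 0%N) M M' k)
      (fun w => enorm (M k.+1 w) ^+ 2 + enorm (M' k.+1 w) ^+ 2) V /\
    {ae P, forall w,
      V w <= c2 * (1 + enorm (x k w) ^+ 2 + enorm (y k w) ^+ 2)}) :
  [/\ {ae P, forall w,
        distance_to (saddle_points X H) (x k w) (y k w) @[k --> \oo] --> (0 : R)},
      (forall v, differentiable (max_value X H) v) &
      exists C : R, forall k, (0 < k)%N ->
        ('E_P[fun w => (enorm (gradient (max_value X H) (y k w)) ^+ 2)%R]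
          <= (C / k%:R `^ (1 / 4 - eps))%:E)%E].
Proof.
have [[xb yb] saddle] := saddle_nonempty; have [Dm X_diam] := X_bounded.
have [G G1 hG] := growth_bound X_bounded L_gt0 H_smooth saddle.
have G0 : 0 < G by apply: lt_le_trans G1.
pose xs := best_response X_nonempty X_closed X_convex X_bounded L_gt0 rho_gt0 H_smooth H_concave.
pose ph := phi X_nonempty X_closed X_convex X_bounded L_gt0 rho_gt0 H_smooth H_concave.
pose dph := dphi X_nonempty X_closed X_convex X_bounded L_gt0 rho_gt0 H_smooth H_concave.
have xs_in v : X (xs v) by exact: best_response_in.
have gy_lip u v : X u -> enorm (dph v - gy u v) <= L * enorm (u - xs v).
  move=> Xu; apply: le_trans (gy_lipschitz H_smooth _ _ (xs_in v) Xu) _.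
  by rewrite subrr enorm2_0r enormB.
have grad v := phi_differentiable X_nonempty X_closed X_convex X_bounded L_gt0 rho_gt0
  H_smooth H_concave H_convex v.
have [bY cZ cW [A A0 hA]] := iterates_limits X_convex L_gt0 rho_gt0
  (Lphi_gt0 L_gt0 rho_gt0) G0 xs_in
  (fun u v => @strong_monotonicity _ _ _ _ _ _ _ _ _ X_nonempty X_closed X_convex X_bounded
    L_gt0 rho_gt0 H_smooth H_concave u v)
  (best_response_lipschitz X_nonempty X_closed X_convex X_bounded L_gt0 rho_gt0 H_smooth H_concave)
  (fun u v Xu => let: And3 h _ _ := hG u v Xu in h)
  (fun u v Xu => let: And3 _ h _ := hG u v Xu in h)
  (fun u v Xu => let: And3 _ _ h := hG u v Xu in h)
  gy_lip
  (phi_lower X_nonempty X_closed X_convex X_bounded L_gt0 rho_gt0 H_smooth H_concave H_convex)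
  (phi_upper X_nonempty X_closed X_convex X_bounded L_gt0 rho_gt0 H_smooth H_concave H_convex)
  (saddle_min X_nonempty X_closed X_convex X_bounded L_gt0 rho_gt0 H_smooth H_concave saddle)
  (dphi_saddle X_nonempty X_closed X_convex X_bounded L_gt0 rho_gt0 H_smooth H_concave
    H_convex saddle)
  (dphi_lipschitz X_nonempty X_closed X_convex X_bounded L_gt0 rho_gt0 H_smooth H_concave)
  (fun v => phi_continuous H_convex (x := v))
  X_diam (fun v => projection_nonempty v X_nonempty X_closed X_diam) H_smooth.2
  eps_bounds alpha_gt0 beta_gt0 K1_ge1 aE bE x0_in x_init y_init x_step y_step M_random
  M'_random M_mean0 M'_mean0 c2_gt0 noise_var.
split.
- apply: filterS3 bY cZ cW => w hY hZ hW.
  exact: (@distance_to_saddle_cvg0 _ _ _ _ _ _ _ _ _ X_nonempty X_closed X_convex X_bounded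
    L_gt0 rho_gt0 H_smooth H_concave H_convex _ _ saddle (x ^~ w) (y ^~ w) hY hZ hW).
- by move=> v; case: (grad v).
exists A => k k0; rewrite unlock.
under eq_integral do rewrite (grad _).2.
(* Removing [K1] from the base only enlarges the negative power; [k > 0] keeps the smaller base
   positive. *)
apply: le_trans (hA k) _; rewrite lee_fin powRN ler_wpM2l//.
have e4 : 0 <= 1 / 4 - eps by case/andP: eps_bounds => _ h; lra.
have kp : 0 < k%:R :> R by rewrite ltr0n.
have K0 : 0 <= K1 by apply: le_trans K1_ge1.
have uk : k%:R <= k%:R + K1 by rewrite lerDl.
rewrite lef_pV2 ?posrE ?powR_gt0 ?(lt_le_trans kp uk)//.
by apply: ge0_ler_powR => //; rewrite nnegrE ltW// (lt_le_trans kp uk).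
Qed.
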